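(* Let $d\ge 1$ and let $K\subset\mathbb{R}^d$ be a compact set such that $\dim_{\mathcal H}(K)>0$. Then the set $$\left\{ f\in\mathcal C(K)\ ;\ \dim_{\mathcal H}\left(\Gamma_f^K\right)=\dim_{\mathcal H}(K)+1\right\}$$ is a prevalent subset of $\mathcal C(K)$.
   Context: $\dim_{\mathcal H}$ denotes Hausdorff dimension. For a compact set $K\subset\mathbb{R}^d$, $\mathcal C(K)$ is the Banach space of real-valued continuous functions on $K$ with the norm $\|f\|_\infty=\sup_{x\in K}|f(x)|$. The graph of $f\in\mathcal C(K)$ is $\Gamma_f^K=\{(x,f(x))\ ;\ x\in K\}\subset\mathbb{R}^{d+1}$. Prevalence: let $E$ be a complete metric vector space. A Borel set $A\subset E$ is called Haar-null if there exists a compactly supported (Borel) probability measure $\mu$ on $E$ such that $\mu(x+A)=0$ for every $x\in E$. An arbitrary subset of $E$ is called Haar-null if it is contained in a Haar-null Borel set. The complement of a Haar-null set is called a prevalent set. *)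

(* Defs.v *)
From HB Require Import structures.
From mathcomp Require Import all_boot all_order all_algebra.
From mathcomp Require Import all_classical all_reals all_analysis.
From mathcomp Require Import ring lra.

Set Implicit Arguments.
Unset Strict Implicit.
Unset Printing Implicit Defensive.

Import Order.TTheory GRing.Theory Num.Theory.
Import numFieldNormedType.Exports.

Local Open Scope classical_set_scope.
Local Open Scope ring_scope.

Section HausdorffDimension.
Context {R : realType} {n : nat}.
Implicit Types (x y : 'rV[R]_n) (A : set 'rV[R]_n) (s delta : R).

(* The norm [`|x|] which the library puts on ['rV[R]_n] is the maximum norm. *)
Definition euclidean_norm x : R := Num.sqrt (\sum_(i < n) x ord0 i ^+ 2).

(* Adding 0 gives the empty set diameter 0 instead of [-oo]. *)
Definition diam A : \bar R :=
  ereal_sup (0%E |` [set (euclidean_norm (x - y))%:E | x in A & y in A]).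

Definition hausdorff_premeasure s delta A : \bar R :=
  ereal_inf [set (\sum_(0 <= i <oo) (diam (U i) `^ s))%E |
    U in [set U : (set 'rV[R]_n)^nat |
      A `<=` \bigcup_i U i /\ forall i, (diam (U i) <= delta%:E)%E]].

(* [hausdorff_premeasure s delta A] increases as [delta] decreases to 0, so that
   its limit is its supremum. *)
Definition hausdorff_measure s A : \bar R :=
  ereal_sup [set hausdorff_premeasure s delta A |
    delta in [set delta | 0 < delta]].

(* The exponent 0 is left out because of the convention 0 `^ 0 = 1, under which
   empty sets in a cover would count; the infimum is not affected. *)
Definition hausdorff_dim A : \bar R :=
  ereal_inf [set s%:E | s in [set s | 0 < s /\ hausdorff_measure s A = 0%E]].

End HausdorffDimension.

Definition borelType (R : realType) (E : completeNormedModType R)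
  : measurableType _ := g_sigma_algebraType (@open E).

Section Prevalence.
Context {R : realType} {E : completeNormedModType R}.
Implicit Types A B : set E.

Definition borel_set : set (set E) := @measurable _ (borelType E).

Definition compactly_supported (mu : probability (borelType E) R) : Prop :=
  exists2 C : set E, compact C & mu C = 1%E.

Definition haar_null_borel B : Prop :=
  borel_set B /\
  exists2 mu : probability (borelType E) R, compactly_supported mu &
    forall x : E, mu [set x + b | b in B] = 0%E.

Definition haar_null A : Prop :=
  exists2 B : set E, haar_null_borel B & A `<=` B.

Definition prevalent A : Prop := haar_null (~` A).

End Prevalence.

(* The proof that K is compact is a parameter because it is needed for the
   supremum norm, and hence for the Banach space structure below. *)
Definition contfun (R : realType) (T : topologicalType) (K : set T)
  (_ : compact K) : Type := continuousType K R.

Section ContinuousFunctions.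
Context {R : realType} {T : topologicalType} {K : set T} (cK : compact K).
Local Notation CK := (contfun R cK).

HB.instance Definition _ := Choice.on CK.

Definition mk_contfun (f : K -> R) (cf : continuous f) : CK :=
  HB.pack_for (continuousType K R) f (@isContinuous.Build _ _ f cf).

Lemma contfun_ext (f g : CK) : (forall x, f x = g x) -> f = g.
Proof. by move=> fg; apply/continuousEP => x; exact: fg. Qed.

Lemma contfun_continuous (f : CK) : continuous (f : K -> R).
Proof. exact: cts_fun. Qed.

Local Lemma add_subproof (f g : CK) : continuous (fun x : K => f x + g x).
Proof.
move=> x; apply: continuousD; exact: contfun_continuous.
Qed.

Local Lemma opp_subproof (f : CK) : continuous (fun x : K => - f x).
Proof. by move=> x; apply: continuousN; exact: contfun_continuous. Qed.

Local Lemma scale_subproof (a : R) (f : CK) : continuous (fun x : K => a * f x).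
Proof.
move=> x; apply: (continuousM (@cst_continuous _ _ a x)).
exact: contfun_continuous.
Qed.

Local Lemma zero_subproof : continuous (fun _ : K => 0 : R).
Proof. exact: cst_continuous. Qed.

Local Definition zero := mk_contfun (@zero_subproof).
Local Definition add f g := mk_contfun (@add_subproof f g).
Local Definition opp f := mk_contfun (@opp_subproof f).
Local Definition scale a f := mk_contfun (@scale_subproof a f).

Local Lemma addA : associative add.
Proof. by move=> f g h; apply: contfun_ext => x /=; rewrite addrA. Qed.

Local Lemma addC : commutative add.
Proof. by move=> f g; apply: contfun_ext => x /=; rewrite addrC. Qed.

Local Lemma add0 : left_id zero add.
Proof. by move=> f; apply: contfun_ext => x /=; rewrite add0r. Qed.

Local Lemma addN : left_inverse zero opp add.
Proof. by move=> f; apply: contfun_ext => x /=; rewrite addNr. Qed.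

HB.instance Definition _ := GRing.isZmodule.Build CK addA addC add0 addN.

Local Lemma scaleA (a b : R) (f : CK) : scale a (scale b f) = scale (a * b) f.
Proof. by apply: contfun_ext => x /=; rewrite mulrA. Qed.

Local Lemma scale1 : left_id 1 scale.
Proof. by move=> f; apply: contfun_ext => x /=; rewrite mul1r. Qed.

Local Lemma scaleDr : right_distributive scale +%R.
Proof. by move=> a f g; apply: contfun_ext => x /=; rewrite mulrDr. Qed.

Local Lemma scaleDl (f : CK) : {morph scale^~ f : a b / a + b}.
Proof. by move=> a b; apply: contfun_ext => x /=; rewrite mulrDl. Qed.

HB.instance Definition _ :=
  GRing.Zmodule_isLmodule.Build R CK scaleA scale1 scaleDr scaleDl.

Lemma contfunD (f g : CK) (x : K) : (f + g) x = f x + g x.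
Proof. by []. Qed.

Lemma contfunN (f : CK) (x : K) : (- f) x = - f x.
Proof. by []. Qed.

Lemma contfunB (f g : CK) (x : K) : (f - g) x = f x - g x.
Proof. by []. Qed.

Lemma contfunZ (a : R) (f : CK) (x : K) : (a *: f) x = a * f x.
Proof. by []. Qed.

(* When K is empty, this is [sup set0 = 0]. *)
Definition sup_norm (f : CK) : R := sup [set `|f x| | x in [set: K]].

Lemma contfun_has_ubound (f : CK) :
  has_ubound [set `|f x| | x in [set: K]].
Proof.
have cf : {within K, continuous (valL_ 0 (f : K -> R))}.
  exact/subspace_valL_continuousP'/contfun_continuous.
have [M [_ fM]] := compact_bounded (continuous_compact cf cK).
exists (M + 1) => _ [x _ <-]; apply: (fM (M + 1)); first by rewrite ltrDl.
exists (\val x); first exact: set_valP.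
by rewrite -[in RHS](valLK 0 (f : K -> R)).
Qed.

Lemma ler_sup_norm (f : CK) (x : K) : `|f x| <= sup_norm f.
Proof. by apply: ub_le_sup; [exact: contfun_has_ubound | exists x]. Qed.

Lemma sup_norm_le (f : CK) (e : R) :
  0 <= e -> (forall x, `|f x| <= e) -> sup_norm f <= e.
Proof.
move=> e0 fe; have [[x0 _]|K0] := pselect (exists x : K, True).
  by apply: ge_sup; [exists `|f x0|, x0 | move=> _ [x _ <-]].
rewrite /sup_norm (_ : [set _ | _ in _] = set0) ?sup0//.
by apply/seteqP; split=> // y [x _ _]; case: K0; exists x.
Qed.

Lemma sup_norm_ge0 (f : CK) : 0 <= sup_norm f.
Proof.
have [[x _]|K0] := pselect (exists x : K, True).
  by exact: le_trans (ler_sup_norm f x).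
rewrite /sup_norm (_ : [set _ | _ in _] = set0) ?sup0//.
by apply/seteqP; split=> // y [x _ _]; case: K0; exists x.
Qed.

Local Lemma ler_sup_normD (f g : CK) :
  sup_norm (f + g) <= sup_norm f + sup_norm g.
Proof.
apply: sup_norm_le => [|x]; first by rewrite addr_ge0 ?sup_norm_ge0.
rewrite contfunD (le_trans (ler_normD _ _))//.
by rewrite lerD ?ler_sup_norm.
Qed.

Local Lemma sup_normZ_le (a : R) (f : CK) :
  sup_norm (a *: f) <= `|a| * sup_norm f.
Proof.
apply: sup_norm_le => [|x]; first by rewrite mulr_ge0 ?sup_norm_ge0.
by rewrite contfunZ normrM ler_wpM2l ?ler_sup_norm.
Qed.

Local Lemma sup_normZ (a : R) (f : CK) : sup_norm (a *: f) = `|a| * sup_norm f.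
Proof.
apply/eqP; rewrite eq_le sup_normZ_le /=.
have [->|a0] := eqVneq a 0; first by rewrite normr0 mul0r sup_norm_ge0.
rewrite -ler_pdivlMl ?normr_gt0// -normfV.
by rewrite -{1}[f](scalerK a0) sup_normZ_le.
Qed.

Local Lemma sup_norm_eq0 (f : CK) : sup_norm f = 0 -> f = 0.
Proof.
move=> f0; apply: contfun_ext => x.
by apply/eqP; rewrite -normr_le0 -f0 ler_sup_norm.
Qed.

HB.instance Definition _ :=
  Lmodule_isNormed.Build R CK ler_sup_normD sup_normZ sup_norm_eq0.

Local Lemma complete (F : set_system CK) : ProperFilter F -> cauchy F -> cvg F.
Proof.
move=> FF Fc.
have {}Fc e : 0 < e -> exists f : CK,
    F [set g : CK | forall x : K, `|f x - g x| < e].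
  move=> e0; have [f Ff] := (cauchyP F).1 Fc _ e0; exists f.
  apply: filterS Ff => g /= fge x.
  by rewrite -contfunB (le_lt_trans (ler_sup_norm _ _)).
pose ev (x : K) (f : CK) : R := f x.
have evc x : cvg (ev x @ F).
  apply/cauchy_cvgP/cauchyP => e /Fc[f Ff]; exists (f x).
  have : F (ev x @^-1` ball (f x) e) by apply: filterS Ff => h fh; exact: fh.
  exact.
pose g x := lim (ev x @ F).
have Fg e : 0 < e -> F [set f : CK | forall x : K, `|g x - f x| <= e].
  move=> e0; have [f Ff] := Fc (e / 2) (divr_gt0 e0 (ltr0n _ 2)).
  have gf x : `|g x - f x| <= e / 2.
    have : (fun h : CK => `|ev x h - f x|) @ F --> `|g x - f x|.
      by apply: cvg_norm; apply: cvgB (evc x) _; exact: cvg_cst.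
    move=> /cvgr_to_le; apply.
    by apply: filterS Ff => h fh; rewrite distrC ltW// fh.
  apply: filterS Ff => h fh x; rewrite (splitr e) -(subrK (f x) (g x)) -addrA.
  by rewrite (le_trans (ler_normD _ _))// lerD// ltW.
have cg : continuous g.
  move=> x; apply/(@cvgrPdist_lt _ _ _ _ (nbhs_filter x)) => e e0.
  have e30 : 0 < e / 3 by rewrite divr_gt0.
  have [f gf] := filter_ex (Fg _ e30).
  have := @contfun_continuous f x.
  move=> /(@cvgrPdist_lt _ _ _ _ (nbhs_filter x))/(_ _ e30).
  apply: (@filterS _ _ (nbhs_filter x)) => y fxy.
  rewrite (_ : g x - g y = (g x - f x) + (f x - f y) - (g y - f y)); last first.
    by rewrite addrA subrK opprB addrA subrK.
  rewrite (le_lt_trans (ler_normB _ _))//.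
  rewrite (_ : e = e / 3 + e / 3 + e / 3).
    rewrite ltr_leD// (le_lt_trans (ler_normD _ _))// ler_ltD//.
  by field.
apply/cvg_ex; exists (mk_contfun cg).
apply/cvgrPdist_lt => e e0.
have e20 : 0 < e / 2 by rewrite divr_gt0.
apply: filterS (Fg _ e20) => f fge.
rewrite (@le_lt_trans _ _ (e / 2))//.
  by apply: sup_norm_le => //; exact: ltW.
by rewrite ltr_pdivrMr// ltr_pMr// ltr1n.
Qed.

HB.instance Definition _ := Uniform_isComplete.Build CK complete.

Lemma contfun_normE (f : CK) : `|f| = sup [set `|f x| | x in [set: K]].
Proof. by []. Qed.

End ContinuousFunctions.

Section Graph.
Context {R : realType} {d : nat} {K : set 'rV[R]_d} {cK : compact K}.

Definition graph (f : contfun R cK) : set 'rV[R]_(d + 1) :=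
  [set row_mx (\val x) (\row_(i < 1) f x) | x in [set: K]].

End Graph.

(* Main.v *)
Require Import Defs.
From HB Require Import structures.
From mathcomp Require Import all_boot all_order all_algebra.
From mathcomp Require Import all_classical all_reals all_analysis.
From mathcomp Require Import ring lra zify.

Set Implicit Arguments.
Unset Strict Implicit.
Unset Printing Implicit Defensive.

Import Order.TTheory GRing.Theory Num.Theory.
Import numFieldNormedType.Exports.

Local Open Scope classical_set_scope.
Local Open Scope ring_scope.

(** Every graph has dimension at most [dim K + 1]: above a ball of radius [r] the
    graph lies in a stack of about [1 / r] balls of comparable radius
    ([graph_ball_cover], [hausdorff_dim_graph_le]).

    For the lower bound, perturb a given function by a random one,
    [g_t = \sum_k a_k w (P_k t) phi_k], with [t] uniform in [0, 1].  Here [w] is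
    the distance to the nearest integer, the amplitudes [a_k] decrease like
    [k ^- 2], the frequencies [P_k] grow so fast that the terms are nearly
    independent, and the [phi_k] are the sines and cosines of [pi 2 ^ m x_i] over
    all scales [m] and coordinates [i].  Since [t |-> g_t] is a continuous curve in
    the space of continuous functions ([curve_continuous]), its law has compact
    support.  Two points at distance about [2 ^- m] are separated by one of the
    [phi_k] of scale [m] ([wave_fun_separates]); given the other terms, its
    coefficient spreads the increment of [f + g_t] between these points evenly
    over an interval of length [a_k].  Hence this increment falls into an interval
    of length [r] with probability at most [r] times a polynomial in [m]
    ([wave_sum_concentration], [increment_concentration]): the perturbed function
    behaves like a random field of Hoelder exponent arbitrarily close to 0.

    Let [0 < q < s < dim K].  Frostman's lemma gives masses on [K] for which a ball
    of radius [2 ^- m] has mass at most a constant times [2 ^- (s m)]; finitely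
    supported ones, one for each resolution, are enough ([frostman_weights]).  Lift
    them to the graph of [f + g_t].  In the expectation of the [(q + 1)]-energy the
    probability that two points at distance [2 ^- m] are [2 ^- p]-close in height
    gains a factor [2 ^- p], which compensates for the additional 1 in the
    exponent, and the polynomial losses are absorbed by the gap between [q] and
    [s].  So the expected energies are bounded uniformly in the resolution
    ([sum_relaxed_energy], [energy_tail_bound]), and almost surely they do not tend
    to infinity.  When they do not, every cover of the graph has a cost bounded
    below, so that the graph has dimension at least [q + 1]
    ([hausdorff_dim_graph_ge]).

    The functions whose energies do tend to infinity form a Borel set, because the
    energies are lower semicontinuous ([energy_open]); by the above the law of [g]
    gives mass 0 to each of its translates ([exceptional_set]).  The union of these
    sets over the rational [q] below [dim K] is the required Haar-null set; the
    same law serves for all [q]. *)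


(** * Null Hausdorff measure and finite covers by balls *)

(** The centres and radii of finitely many balls.  Only such covers are needed
    for a compact set, and those by balls of the maximum norm are as good as any
    others, since the dimension does not depend on the norm. *)
Definition ball_cover {R : realType} {V : normedModType R} (K : set V)
    (l : seq (V * R)) : Prop :=
  (forall p, p \in l -> 0 < p.2) /\
  forall x, K x -> exists2 p, p \in l & `|p.1 - x| < p.2.

Section MaxNorm.
Context {R : realType} {n : nat}.
Implicit Types (x y : 'rV[R]_n) (A : set 'rV[R]_n).

Lemma rV_coord_le x i : `|x ord0 i| <= `|x|.
Proof.
rewrite -[leRHS]/(mx_norm x) mx_normrE.
exact: (le_bigmax _ (fun ij : 'I_1 * 'I_n => `|x ij.1 ij.2|) (ord0, i)).
Qed.

Lemma rV_norm_le x (r : R) : 0 <= r -> (forall i, `|x ord0 i| <= r) -> `|x| <= r.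
Proof.
move=> r0 xr; rewrite -[leLHS]/(mx_norm x) mx_normrE.
by apply: bigmax_le => // -[i j] _ /=; rewrite ord1.
Qed.

Lemma norm_le_euclidean x : `|x| <= euclidean_norm x.
Proof.
apply: rV_norm_le => [|i]; first exact: sqrtr_ge0.
rewrite -sqrtr_sqr ler_wsqrtr// (bigD1 i)//= lerDl sumr_ge0// => j _.
exact: sqr_ge0.
Qed.

Lemma euclidean_le_norm x : euclidean_norm x <= n%:R * `|x|.
Proof.
have nx0 : 0 <= n%:R * `|x| by rewrite mulr_ge0.
rewrite -[leRHS]ger0_norm// -sqrtr_sqr ler_wsqrtr// exprMn.
apply: (@le_trans _ _ (n%:R * `|x| ^+ 2)).
  rewrite (_ : n%:R * _ = \sum_(i < n) `|x| ^+ 2); last first.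
    by rewrite sumr_const card_ord mulr_natl.
  apply: ler_sum => i _.
  by rewrite -[leLHS]real_normK ?num_real// lerXn2r ?nnegrE// rV_coord_le.
by rewrite ler_wpM2r ?sqr_ge0// -natrX ler_nat; case: n => // m; rewrite leq_pmulr.
Qed.

Lemma diam_ge0 A : (0 <= diam A)%E.
Proof. by apply: ereal_sup_ubound; left. Qed.

Lemma norm_le_diam A x y : A x -> A y -> (`|x - y|%:E <= diam A)%E.
Proof.
move=> Ax Ay; apply: (@le_trans _ _ (euclidean_norm (x - y))%:E).
  by rewrite lee_fin norm_le_euclidean.
by apply: ereal_sup_ubound; right; exists x => //; exists y.
Qed.

Lemma diam_le A (r : R) : 0 <= r ->
  (forall x y, A x -> A y -> `|x - y| <= r) -> (diam A <= (n%:R * r)%:E)%E.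
Proof.
move=> r0 Ar; apply/ereal_supP => _ [->|[x Ax [y Ay <-]]].
  by rewrite lee_fin mulr_ge0.
by rewrite lee_fin (le_trans (euclidean_le_norm _))// ler_wpM2l// Ar.
Qed.

Lemma diam_set0 : diam (set0 : set 'rV[R]_n) = 0%E.
Proof.
apply/eqP; rewrite eq_le diam_ge0 andbT.
by apply: le_trans (diam_le (lexx 0) _) _ => //; rewrite mulr0.
Qed.

End MaxNorm.

Section BallCovers.
Context {R : realType} {n : nat}.
Implicit Types (A : set 'rV[R]_n) (l : seq ('rV[R]_n * R)).

Lemma sum_half_geometric (e : R) m :
  \sum_(0 <= i < m) e / 2 ^+ i.+1 = e - e / 2 ^+ m.
Proof.
elim: m => [|m IH]; first by rewrite big_geq// expr0 divr1 subrr.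
by rewrite big_nat_recr//= IH exprS; field; rewrite expf_neq0.
Qed.

Lemma hausdorff_premeasure_ge0 s delta A :
  (0 <= hausdorff_premeasure s delta A)%E.
Proof.
by apply/ereal_infP => _ [U _ <-]; apply: nneseries_ge0 => *; apply: poweR_ge0.
Qed.

(** Each set of a cover is enlarged to an open ball, at a cost which is summable
    and small; compactness leaves finitely many of them. *)
Lemma hausdorff_null_ball_cover A (s eta : R) : compact A -> 0 < s -> 0 < eta ->
  hausdorff_measure s A = 0%E ->
  exists2 l, ball_cover A l & \sum_(p <- l) p.2 `^ s < eta.
Proof.
move=> cA s0 eta0 HA.
have e0 : 0 < eta / 2 by rewrite divr_gt0.
have : (hausdorff_premeasure s 1 A < (eta / 2)%:E)%E.
  apply: (@le_lt_trans _ _ 0%E); last by rewrite lte_fin.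
  by rewrite -HA; apply: ereal_sup_ubound; exists 1 => //=; exact: ltr01.
move=> /ereal_inf_lt[_ [U [AU U1] <-] Ue].
pose d i := fine (diam (U i)).
have d0 i : 0 <= d i by rewrite fine_ge0// diam_ge0.
have dE i : diam (U i) = (d i)%:E.
  rewrite fineK// ge0_fin_numE ?diam_ge0//.
  by apply: le_lt_trans (U1 i) _; rewrite ltry.
(* The radius exceeds the diameter even when the latter is 0. *)
pose r i := (d i `^ s + eta / 2 / 2 ^+ i.+1) `^ s^-1.
have sum0 i : 0 < eta / 2 / 2 ^+ i.+1 by rewrite divr_gt0// exprn_gt0.
have rs i : r i `^ s = d i `^ s + eta / 2 / 2 ^+ i.+1.
  by rewrite -powRrM mulVf ?gt_eqF// powRr1// addr_ge0 ?powR_ge0// ltW.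
have dr i : d i < r i.
  rewrite -[ltLHS](powRr1 (d0 i)) -(divff (lt0r_neq0 s0)) powRrM.
  apply: gt0_ltr_powR; rewrite ?invr_gt0// ?nnegrE ?powR_ge0//.
  - by rewrite addr_ge0 ?powR_ge0// ltW.
  - by rewrite ltrDl.
pose z i := xget 0 (U i).
have Uz i x : U i x -> `|z i - x| < r i.
  move=> Ux; apply: le_lt_trans (dr i); rewrite -lee_fin -dE.
  by apply: norm_le_diam => //; rewrite /z; case: xgetP => // /(_ x).
move: cA; rewrite compact_cover.
move=> /(_ nat setT (fun i => ball (z i) (r i)))[i _|x /AU[i _ Ux]|D _ AD].
- exact: ball_open.
- by exists i => //; rewrite -ball_normE; exact: Uz.
pose m := (\max_(i <- finmap.enum_fset D) i).+1.
exists [seq (z i, r i) | i <- index_iota 0 m].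
  split=> [p /mapP[i _ ->]|x /AD[i iD]]; first exact: le_lt_trans (d0 i) (dr i).
  rewrite -ball_normE => zx; exists (z i, r i) => //.
  apply/mapP; exists i => //; rewrite mem_index_iota/= ltnS.
  exact: (@leq_bigmax_seq _ _ predT id).
rewrite big_map/= (eq_bigr _ (fun i _ => rs i)) big_split/= sum_half_geometric.
have : (\sum_(0 <= i < m) (d i `^ s)%:E < (eta / 2)%:E)%E.
  apply: le_lt_trans Ue; rewrite [leRHS](_ : _ = \sum_(0 <= i <oo) (d i `^ s)%:E)%E.
    by apply: nneseries_lim_ge => i _ _; rewrite lee_fin powR_ge0.
  by apply: eq_eseriesr => i _; rewrite dE poweR_EFin.
rewrite sumEFin lte_fin => h.
have : 0 < eta / 2 / 2 ^+ m by rewrite divr_gt0// exprn_gt0.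
lra.
Qed.

(** When the cost of a cover is small, so is each of its radii: the bound on the
    diameters comes for free. *)
Lemma ball_cover_hausdorff_null A (s : R) : 0 < s ->
  (forall eta : R, 0 < eta ->
    exists2 l, ball_cover A l & \sum_(p <- l) p.2 `^ s < eta) ->
  hausdorff_measure s A = 0%E.
Proof.
move=> s0 small; apply/eqP; rewrite eq_le; apply/andP; split; last first.
  apply: (@le_trans _ _ (hausdorff_premeasure s 1 A)).
    exact: hausdorff_premeasure_ge0.
  by apply: ereal_sup_ubound; exists 1 => //=; exact: ltr01.
apply/ereal_supP => _ [delta delta0 <-]; apply/lee_addgt0Pr => e e0.
rewrite add0e; pose c : R := (n%:R * 2) + 1.
have c0 : 0 < c by rewrite ltr_wpDl// mulr_ge0.
have cs0 : 0 < c `^ s by rewrite powR_gt0.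
have [|l [l0 lA] ls] := small (Num.min ((delta / c) `^ s) (e / c `^ s)).
  by rewrite lt_min powR_gt0 ?divr_gt0.
move: ls; rewrite lt_min => /andP[ls1 ls2].
pose z i := (nth (0, 0) l i).1; pose r i := (nth (0, 0) l i).2.
have r0 i : (i < size l)%N -> 0 < r i by move=> il; apply: l0; exact: mem_nth.
pose U i : set 'rV[R]_n :=
  if (i < size l)%N then [set x | `|z i - x| < r i] else set0.
have Ud i : (i < size l)%N -> (diam (U i) <= (c * r i)%:E)%E.
  move=> il; have ri := r0 i il.
  apply: (@le_trans _ _ (n%:R * (2 * r i))%:E).
    apply: diam_le => [|x y]; first by rewrite mulr_ge0// ltW.
    rewrite /U il /= => zx zy.
    rewrite -(subrKA (z i)) -opprB mulr2n mulrDl mul1r.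
    rewrite (le_trans (ler_normD _ _))// lerD ?ltW// normrN//.
  by rewrite lee_fin /c [leRHS]mulrDl mul1r mulrA lerDl ltW.
have Us : (\sum_(0 <= i <oo) (diam (U i) `^ s) <= e%:E)%E.
  rewrite (nneseries_split 0 (size l)); last by move=> *; exact: poweR_ge0.
  rewrite add0n [X in (_ + X)%E]eseries0 ?adde0; last first.
    move=> i li _; rewrite /U ltnNge li/= diam_set0.
    by rewrite poweR_EFin powR0// gt_eqF.
  apply: (@le_trans _ _ (\sum_(0 <= i < size l) ((c * r i) `^ s)%:E)%E).
    rewrite !big_mkord; apply: lee_sum => i _; rewrite -poweR_EFin.
    apply: gt0_ler_poweR; first exact: ltW.
    - by rewrite in_itv/= diam_ge0 leey.
    - by rewrite in_itv/= lee_fin mulr_ge0 ?leey// ltW// r0.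
    - exact: Ud (ltn_ord i).
  rewrite sumEFin lee_fin big_mkord.
  rewrite (eq_bigr (fun i : 'I__ => c `^ s * r i `^ s)); last first.
    by move=> i _; rewrite powRM// ltW// r0.
  rewrite -mulr_sumr mulrC -ler_pdivlMr// ltW//.
  by rewrite (big_nth (0, 0)) big_mkord in ls2.
apply: le_trans Us; apply: ereal_inf_lbound; exists U => //; split=> [x Ax|i].
  have [p pl px] := lA x Ax; exists (index p l) => //.
  by rewrite /U /z /r index_mem pl/= nth_index.
have [il|il] := ltnP i (size l); last first.
  by rewrite /U ltnNge il/= diam_set0 lee_fin ltW.
apply: le_trans (Ud i il) _; rewrite lee_fin mulrC -ler_pdivlMr// leNgt.
apply/negP => cr; move: ls1; apply/negP; rewrite -leNgt.
apply: (@le_trans _ _ (r i `^ s)).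
  by apply: ge0_ler_powR; rewrite ?nnegrE ?ltW// ?divr_gt0// r0.
rewrite (big_nth (0, 0)) big_mkord (bigD1 (Ordinal il))//= lerDl sumr_ge0// => *.
exact: powR_ge0.
Qed.

End BallCovers.

(** * The upper bound on the dimension of a graph *)

Section HausdorffDim.
Context {R : realType} {n : nat}.
Implicit Types (A : set 'rV[R]_n).

Lemma hausdorff_dim_le A (s : R) : 0 < s -> hausdorff_measure s A = 0%E ->
  (hausdorff_dim A <= s%:E)%E.
Proof. by move=> s0 As; apply: ereal_inf_lbound; exists s. Qed.

(** A cheap cover consists of small balls, for which a larger exponent costs
    less: so the exponent [u] rules out all the smaller ones. *)
Lemma hausdorff_dim_ge A (u : R) : compact A -> 0 < u ->
  (exists2 c : R, 0 < c & forall l, ball_cover A l -> c <= \sum_(p <- l) p.2 `^ u) ->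
  (u%:E <= hausdorff_dim A)%E.
Proof.
move=> cA u0 [c c0 Ac]; apply/ereal_infP => _ [s [s0 As] <-].
rewrite lee_fin leNgt; apply/negP => su.
have [|l lA ls] := @hausdorff_null_ball_cover _ _ _ _ (Num.min c 1) cA s0 _ As.
  by rewrite lt_min c0 ltr01.
move: ls; rewrite lt_min => /andP[lc l1].
have := Ac l lA; rewrite leNgt => /negP; apply; apply: le_lt_trans lc.
rewrite big_seq [leRHS]big_seq; apply: ler_sum => p pl.
have p0 : 0 < p.2 by case: lA => + _; apply.
have p1 : p.2 <= 1.
  rewrite leNgt; apply/negP => p1; move: l1; apply/negP; rewrite -leNgt.
  apply: (@le_trans _ _ (p.2 `^ s)).
    apply: (@le_trans _ _ (1 `^ s)); first by rewrite powR1.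
    by apply: ge0_ler_powR; rewrite ?nnegrE ?ltW.
  rewrite (big_rem p pl)/= lerDl sumr_ge0// => q _; exact: powR_ge0.
have -> : p.2 `^ u = p.2 `^ s * p.2 `^ (u - s).
  by rewrite -powRD ?(gt_eqF p0) ?implybT// addrC subrK.
apply: ler_piMr; first exact: powR_ge0.
apply: (@le_trans _ _ (1 `^ (u - s))); last by rewrite powR1.
by apply: ge0_ler_powR; rewrite ?nnegrE ?subr_ge0 // ?ltW.
Qed.

End HausdorffDim.

Section GraphGeometry.
Context {R : realType} {d : nat}.
Implicit Types (x y : 'rV[R]_d) (a b : R).

Definition graph_point x a : 'rV[R]_(d + 1) := row_mx x (\row_(i < 1) a).

Lemma graph_point_dist_le x y a b (r : R) :
  `|x - y| <= r -> `|a - b| <= r -> `|graph_point x a - graph_point y b| <= r.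
Proof.
move=> xy ab; apply: rV_norm_le => [|i]; first exact: le_trans (normr_ge0 _) ab.
rewrite -(splitK i); case: (fintype.split i) => j; rewrite !mxE /=.
  rewrite (unsplitK (inl j)); have := rV_coord_le (x - y) j; rewrite !mxE.
  by move=> /le_trans; apply.
by rewrite (unsplitK (inr j)) !mxE.
Qed.

Lemma dist_le_graph_point x y a b :
  `|x - y| <= `|graph_point x a - graph_point y b|.
Proof.
apply: rV_norm_le => // i; have := rV_coord_le (graph_point x a - graph_point y b)
  (lshift 1 i).
by rewrite !mxE (unsplitK (inl i)).
Qed.

Lemma dist_le_graph_point_snd x y a b :
  `|a - b| <= `|graph_point x a - graph_point y b|.
Proof.
have := rV_coord_le (graph_point x a - graph_point y b) (rshift d ord0).
by rewrite !mxE (unsplitK (inr ord0)) !mxE.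
Qed.

End GraphGeometry.

Section GraphUpperBound.
Context {R : realType} {d : nat} {K : set 'rV[R]_d} {cK : compact K}.
Implicit Types f : contfun R cK.

Lemma graph_compact f : compact (graph f).
Proof.
pose F (x : 'rV[R]_d) := graph_point x (valL_ 0 (f : K -> R) x).
have FE : graph f = F @` K.
  apply/seteqP; split=> [_ [x _ <-]|_ [x Kx <-]].
    exists (\val x); first exact: set_valP.
    by rewrite /F -[in RHS](valLK 0 (f : K -> R)).
  exists (SigSub (mem_set Kx)) => //.
  by rewrite /F -[in LHS](valLK 0 (f : K -> R)).
rewrite FE; apply: continuous_compact cK.
have cf : {within K, continuous (valL_ 0 (f : K -> R))}.
  exact/subspace_valL_continuousP'/contfun_continuous.
move=> x; apply/cvgrPdist_le => e e0.
have fx := (cvgrPdist_le _ _).1 (cf x) e e0.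
have idx : {within K, continuous (id : 'rV[R]_d -> 'rV[R]_d)}.
  by apply: continuous_subspaceT => y; exact: cvg_id.
have xx := (cvgrPdist_le _ _).1 (idx x) e e0.
near=> y; apply: graph_point_dist_le; [near: y; exact: xx|near: y; exact: fx].
Unshelve. all: by end_near.
Qed.

(** Over a ball of radius [r] the graph lies in a stack of about [2 |f| / r]
    balls of radius [2 r]: the factor [1 / r] costs one dimension. *)
Lemma graph_ball_cover f l : ball_cover K l -> (forall p, p \in l -> p.2 <= 1) ->
  exists2 l' : seq ('rV[R]_(d + 1) * R), ball_cover (graph f) l' &
    forall s, 0 < s ->
      \sum_(p <- l') p.2 `^ (s + 1)
        <= (2 * `|f| + 1) * 2 `^ (s + 1) * \sum_(p <- l) p.2 `^ s.
Proof.
move=> [l0 lK] l1; set b := `|f|.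
pose m (p : 'rV[R]_d * R) := (Num.trunc (2 * b / p.2)).+1.
have b0 : 0 <= b := normr_ge0 f.
exists [seq (graph_point p.1 (- b + k%:R * p.2), 2 * p.2) | p <- l, k <- iota 0 (m p)].
  split=> [_ /allpairsPdep[p [k [pl _ ->]]]|_ [x _ <-]].
    by rewrite mulr_gt0// l0.
  have [p pl px] := lK (\val x) (set_valP x).
  have p0 := l0 p pl.
  have fb : `|f x| <= b := ler_sup_norm f x.
  move: fb; rewrite ler_norml => /andP[fb1 fb2].
  rewrite -/(graph_point (\val x) (f x)); move: (f x : R) fb1 fb2 => y fb1 fb2.
  have q0 : 0 <= (y + b) / p.2 by rewrite divr_ge0 ?(ltW p0)//; lra.
  pose k := Num.trunc ((y + b) / p.2).
  have kq : k%:R <= (y + b) / p.2 by rewrite truncn_le.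
  have qk : (y + b) / p.2 < k.+1%:R by rewrite -truncn_le_nat.
  exists (graph_point p.1 (- b + k%:R * p.2), 2 * p.2).
    apply/allpairsPdep; exists p, k; split => //.
    rewrite mem_iota/= add0n ltnS; apply: le_truncn.
    by rewrite ler_pM2r ?invr_gt0//; lra.
  apply: (@le_lt_trans _ _ p.2); last by rewrite /= ltr_pMl// ltr1n.
  apply: graph_point_dist_le; first exact: ltW.
  rewrite ler_pdivlMr// in kq; rewrite ltr_pdivrMr// -natr1 mulrDl mul1r in qk.
  by rewrite ler_norml; apply/andP; split; lra.
move=> s s0; rewrite big_allpairs_dep mulr_sumr.
rewrite big_seq [leRHS]big_seq; apply: ler_sum => p pl.
have p0 := l0 p pl; have p1 := l1 p pl.
rewrite -[leLHS]/(\sum_(k <- iota 0 (m p)) (2 * p.2) `^ (s + 1)).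
rewrite big_const_seq count_predT size_iota iter_addr_0 -[leLHS]mulr_natl.
rewrite powRM ?(ltW p0)//.
rewrite [p.2 `^ (s + 1)]powRD ?(gt_eqF p0) ?implybT// powRr1 ?(ltW p0)//.
have mp : (m p)%:R * p.2 <= 2 * b + 1.
  rewrite /m -natr1 mulrDl mul1r lerD// -ler_pdivlMr// truncn_le.
  by rewrite divr_ge0 ?mulr_ge0 ?(ltW p0).
have X0 : 0 <= 2 `^ (s + 1) * p.2 `^ s by rewrite mulr_ge0 ?powR_ge0.
have := ler_wpM2r X0 mp; congr (_ <= _); ring.
Qed.

Lemma hausdorff_dim_graph_le f :
  (hausdorff_dim (graph f) <= hausdorff_dim K + 1)%E.
Proof.
rewrite -leeBlDr//; apply/ereal_infP => _ [s [s0 Ks] <-].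
rewrite leeBlDr// -EFinD; apply: hausdorff_dim_le; first by rewrite addr_gt0.
apply: ball_cover_hausdorff_null => [|eta eta0]; first by rewrite addr_gt0.
pose C := (2 * `|f| + 1) * 2 `^ (s + 1).
have C0 : 0 < C.
  by rewrite mulr_gt0 ?powR_gt0// ltr_wpDl// mulr_ge0.
have [|l lK] := @hausdorff_null_ball_cover _ _ _ _ (Num.min 1 (eta / C)) cK s0 _ Ks.
  by rewrite lt_min ltr01 divr_gt0.
rewrite lt_min => /andP[ls1 lsC].
have [p pl|l' l'f l's] := @graph_ball_cover f l lK.
  rewrite leNgt; apply/negP => p1; move: ls1; apply/negP; rewrite -leNgt.
  apply: (@le_trans _ _ (p.2 `^ s)).
    apply: (@le_trans _ _ (1 `^ s)); first by rewrite powR1.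
    by apply: ge0_ler_powR; rewrite ?nnegrE ?ltW// (lt_trans ltr01).
  rewrite (big_rem p pl)/= lerDl sumr_ge0// => q _; exact: powR_ge0.
exists l' => //; apply: le_lt_trans (l's s s0) _.
by rewrite -/C mulrC -ltr_pdivlMr.
Qed.

End GraphUpperBound.


(** * Finite Frostman weights *)

Section FiniteCombinatorics.
Context {R : realType}.

(** Give each point in turn the largest weight that the constraints still
    allow.  A constraint which has become tight stays tight, since it blocks
    every later point of its set. *)
Lemma greedy_weights (I J : finType) (B : J -> {set I}) (beta : J -> R) :
  (forall j, 0 <= beta j) -> (forall i, exists j, i \in B j) ->
  exists nu : I -> R, [/\ forall i, 0 <= nu i,
    forall j, \sum_(i in B j) nu i <= beta j &
    forall i, exists2 j, i \in B j & \sum_(i' in B j) nu i' = beta j].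
Proof.
move=> beta0 coverB.
suff [nu [nu0 nuB nuT]] : exists nu : I -> R, [/\ forall i, 0 <= nu i,
    forall j, \sum_(i in B j) nu i <= beta j &
    forall i, i \in enum I ->
      exists2 j, i \in B j & \sum_(i' in B j) nu i' = beta j].
  by exists nu; split=> // i; apply: nuT; rewrite mem_enum.
elim: (enum I) => [|i0 s [nu [nu0 nuB nuT]]].
  by exists (fun=> 0); split=> // j; rewrite big1.
have [j0 ij0] := coverB i0.
pose slack j := beta j - \sum_(i in B j) nu i.
have [j1 ij1 j1min] :=
  Order.TotalTheory.arg_minP (P := fun j => i0 \in B j) slack ij0.
pose nu' i := nu i + (if i == i0 then slack j1 else 0).
have sE j : \sum_(i in B j) nu' i
    = \sum_(i in B j) nu i + (if i0 \in B j then slack j1 else 0).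
  rewrite big_split/=; congr (_ + _).
  rewrite -big_mkcondr/=; case: ifPn => ij.
    rewrite (bigD1 i0) ?ij ?eqxx//= big1 ?addr0// => i.
    by case/andP => /andP[_ /eqP ->]; rewrite eqxx.
  by rewrite big1// => i /andP[ij' /eqP ii]; rewrite ii (negbTE ij) in ij'.
have slack0 j : 0 <= slack j by rewrite subr_ge0.
exists nu'; split=> [i|j|i].
- by rewrite addr_ge0//; case: ifP.
- rewrite sE; case: ifPn => ij; last by rewrite addr0.
  by rewrite -lerBrDl; exact: j1min.
- rewrite inE => /predU1P[->|/nuT[j ij jT]].
    by exists j1 => //; rewrite sE ij1 addrC subrK.
  exists j => //; rewrite sE jT; case: ifPn => i0j; last by rewrite addr0.
  apply/eqP; rewrite -subr_eq0 addrAC subrr add0r eq_le slack0 andbT.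
  by apply: le_trans (j1min _ i0j) _; rewrite /slack jT subrr.
Qed.

(** The finite form of Vitali's covering lemma: keep a set of least rank,
    discard those which meet it, and repeat. *)
Lemma disjoint_subfamily (T I : finType) (B : T -> {set I}) (rk : T -> nat)
    (P : {set T}) : (forall t, t \in P -> B t != finset.set0) ->
  exists D : {set T}, [/\ D \subset P,
    forall t u, t \in D -> u \in D -> t != u -> (B t :&: B u == finset.set0) &
    forall t, t \in P ->
      exists u, [/\ u \in D, (rk u <= rk t)%N & B t :&: B u != finset.set0]].
Proof.
elim: {P}#|P| {-2}P (leqnn #|P|) => [|n IH] P.
  rewrite leqn0 cards_eq0 => /eqP-> _; exists finset.set0; split=> [//|t u|t].
    by rewrite inE.
  by rewrite inE.
move=> Pn PB; have [->|/set0Pn[t0' Pt0']] := eqVneq P finset.set0.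
  by exists finset.set0; split=> [//|t u|t]; rewrite inE.
have [t0 Pm t0min] := arg_minnP rk Pt0'; have Pt0 : t0 \in P := Pm.
have BB0 : B t0 :&: B t0 != finset.set0 by rewrite finset.setIid PB.
pose P' := finset (fun t => (t \in P) && (B t :&: B t0 == finset.set0)).
have P'E t : (t \in P') = (t \in P) && (B t :&: B t0 == finset.set0).
  by rewrite inE.
have P'P : P' \subset P by apply/fintype.subsetP => t; rewrite P'E => /andP[].
have {}Pn : (#|P'| <= n)%N.
  rewrite -ltnS; apply: leq_trans Pn; apply: proper_card.
  rewrite properE P'P/=; apply/fintype.subsetPn; exists t0 => //.
  by rewrite P'E Pt0 (negbTE BB0).
have [t P't|D [DP' DD DC]] := IH P' Pn.
  by apply: PB; apply: (fintype.subsetP P'P).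
exists (t0 |: D)%SET; split=> [|t u|t Pt].
- by rewrite finset.subUset finset.sub1set Pt0 (fintype.subset_trans DP').
- rewrite !inE => /predU1P[->|tD] /predU1P[->|uD]; first by rewrite eqxx.
  + by have := fintype.subsetP DP' _ uD; rewrite P'E finset.setIC => /andP[].
  + by have := fintype.subsetP DP' _ tD; rewrite P'E => /andP[].
  + exact: DD.
- have [dis|dis] := boolP (B t :&: B t0 == finset.set0); last first.
    by exists t0; rewrite !inE eqxx t0min.
  have [|u [uD ? ?]] := DC t; first by rewrite P'E Pt.
  by exists u; rewrite !inE uD orbT.
Qed.

End FiniteCombinatorics.

Lemma half_expn_powR {R : realType} (s : R) n :
  (2^-1 ^+ n) `^ s = (2 `^ s)^-1 ^+ n.
Proof.
have h0 : 0 <= 2^-1 :> R by rewrite invr_ge0.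
rewrite -powR_mulrn// -powRrM mulrC powRrM powR_mulrn ?powR_ge0//.
by rewrite -powR_inv1// -powRrM mulN1r powRN.
Qed.

Section Frostman.
Context {R : realType} {V : normedModType R}.
Implicit Types (K : set V) (l : seq (V * R)).

Lemma compact_net K (r : R) : compact K -> 0 < r ->
  exists2 s : seq V, (forall y, y \in s -> K y) &
    forall x, K x -> exists2 y, y \in s & `|y - x| < r.
Proof.
rewrite compact_cover => cK r0.
have [||D DK KD] := cK V K (fun x => ball x r).
- by move=> i _; exact: ball_open.
- by move=> x Kx; exists x => //; exact: ballxx.
exists (finmap.enum_fset D) => [y yD|x /KD[y /= yD yx]].
  by have := DK _ yD; rewrite inE.
by exists y => //; move: yx; rewrite -ball_normE.
Qed.

(** A finite form of Frostman's lemma, uniform in the resolution [N]; it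
    replaces a limit measure on [K].  Take a net of mesh [2^-1 ^+ N] and the
    greedy weights for the constraints that a ball of radius [2^-1 ^+ n] has
    mass at most its radius to the power [s].  Every point lies in a saturated
    ball; a disjoint subfamily of the saturated balls, enlarged four times,
    covers [K], so that the total mass is at least [eta / 4 `^ s]. *)
Lemma frostman_weights K (s eta : R) : compact K -> 0 < s -> 0 < eta ->
  (forall l, ball_cover K l -> eta <= \sum_(p <- l) p.2 `^ s) ->
  exists2 C : R, 0 < C & forall N : nat,
    exists (I : finType) (pt : I -> V) (nu : I -> R),
      [/\ forall i, K (pt i), forall i, 0 <= nu i, \sum_i nu i = 1 &
      forall i n, (n <= N)%N ->
        \sum_(j | `|pt i - pt j| <= 2^-1 ^+ n) nu j <= C * (2 `^ s)^-1 ^+ n].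
Proof.
move=> cK s0 eta0 etaP; pose h : R := 2^-1.
have h0 : 0 < h by rewrite invr_gt0.
have h1 : h <= 1 by rewrite invf_le1 ?ler1n.
have S0 : 0 < 4 `^ s :> R by rewrite powR_gt0.
exists (4 `^ s / eta); first by rewrite divr_gt0.
move=> N; have [F FK Fnet] := compact_net cK (exprn_gt0 N h0).
pose I : finType := seq_sub F; pose pt (i : I) : V := ssval i.
pose J : finType := (I * 'I_N.+1)%type.
pose B (p : J) : {set I} := finset (fun j => `|pt p.1 - pt j| <= h ^+ p.2).
have inB (p : J) j : (j \in B p) = (`|pt p.1 - pt j| <= h ^+ p.2).
  by rewrite inE.
have selfB (p : J) : p.1 \in B p by rewrite inB subrr normr0 exprn_ge0 ?ltW.
pose beta (p : J) : R := (h ^+ p.2) `^ s.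
have [|i|nu [nu0 nuB nuT]] := @greedy_weights R I J B beta.
- by move=> p; exact: powR_ge0.
- by exists (i, ord0); exact: selfB.
pose P : {set J} := finset (fun p => \sum_(i in B p) nu i == beta p).
have [p _|D [DP DD DC]] := @disjoint_subfamily J I B (fun p => p.2) P.
  by apply/set0Pn; exists p.1.
pose M := \sum_i nu i.
have etaM : eta <= 4 `^ s * M.
  pose l := [seq (pt p.1, 4 * h ^+ p.2) | p : J <- enum D].
  have : ball_cover K l.
    split=> [q /mapP[p _ ->]|x Kx]; first by rewrite mulr_gt0// exprn_gt0.
    have [y yF yx] := Fnet x Kx.
    pose j : I := SeqSub yF.
    have [p jp pT] := nuT j.
    have [|q [qD qp /set0Pn[k]]] := DC p; first by rewrite inE pT.
    rewrite finset.inE => /andP[kp kq].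
    exists (pt q.1, 4 * h ^+ q.2); first by apply/mapP; exists q; rewrite ?mem_enum.
    rewrite /= (_ : pt q.1 - x = (pt q.1 - pt k) - (pt p.1 - pt k)
      + (pt p.1 - pt j) + (pt j - x)); last first.
      by rewrite opprB !addrA !subrK.
    have hN : h ^+ N <= h ^+ q.2.
      by apply: ler_wiXn2l => //; [exact: ltW|rewrite -ltnS; exact: ltn_ord].
    have hpq : h ^+ p.2 <= h ^+ q.2 by apply: ler_wiXn2l => //; exact: ltW.
    move: jp kp kq; rewrite !inB => jp kp kq.
    (* Three steps of length at most that of the radius of [q], and one strictly
       shorter than the mesh: hence the factor 4. *)
    rewrite (le_lt_trans (ler_normD _ _))//.
    apply: (@lt_le_trans _ _ (h ^+ q.2 + h ^+ p.2 + h ^+ p.2 + h ^+ N)).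
      apply: ler_ltD => //; rewrite (le_trans (ler_normD _ _))// lerD//.
      by rewrite (le_trans (ler_normB _ _))// lerD.
    lra.
  move=> /etaP; rewrite big_map big_enum/= => /le_trans; apply.
  rewrite (eq_bigr (fun p => 4 `^ s * \sum_(i in B p) nu i)); last first.
    move=> p /(fintype.subsetP DP); rewrite inE => /eqP ->.
    by rewrite powRM// exprn_ge0 ?ltW.
  rewrite -mulr_sumr ler_pM2l//.
  rewrite (exchange_big_dep predT)//=; apply: ler_sum => i _.
  have [p0 /andP[p0D ip0]|none] := pickP [pred p | (p \in D) && (i \in B p)].
    rewrite (bigD1 p0) ?p0D//= big1 ?addr0// => p /andP[/andP[pD ip] pp0].
    move: (DD _ _ pD p0D pp0) => /eqP/setP/(_ i).
    by rewrite finset.in_setI ip ip0 finset.in_set0.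
  by rewrite big_pred0.
have M0 : 0 < M by rewrite -(pmulr_rgt0 _ S0) (lt_le_trans eta0).
exists I, pt, (fun i => nu i / M); split=> [i|i||i n nN].
- exact/FK/valP.
- by rewrite divr_ge0// ltW.
- by rewrite -mulr_suml divff// gt_eqF.
- rewrite -mulr_suml ler_pdivrMr//.
  have nN1 : (n < N.+1)%N by [].
  apply: (@le_trans _ _ (beta (i, Ordinal nN1))).
    apply: le_trans (nuB _); rewrite le_eqVlt; apply/orP; left; apply/eqP.
    by apply: eq_bigl => j; rewrite inB.
  rewrite /beta /= half_expn_powR.
  rewrite -[leLHS]mul1r mulrAC ler_pM2r ?exprn_gt0 ?invr_gt0 ?powR_gt0//.
  by rewrite mulrAC ler_pdivlMr// mul1r.
Qed.

End Frostman.

(** * Energies of graphs *)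

Section Energy.
Context {R : realType}.

Lemma dyadic_level (x : R) : 0 < x -> x <= 1 ->
  exists n, 2^-1 ^+ n.+1 < x <= 2^-1 ^+ n.
Proof.
move=> x0 x1; have ex : exists n, (2^-1 : R) ^+ n < x.
  exists (Num.trunc x^-1).+1; rewrite exprVn invf_plt ?posrE ?exprn_gt0//.
  apply: (@lt_le_trans _ _ (Num.trunc x^-1).+1%:R).
    by rewrite -truncn_le_nat.
  by rewrite -natrX ler_nat ltnW// ltn_expl.
case: (ex_minnP ex) => -[|n] nx min.
  by move: (lt_le_trans nx x1); rewrite expr0 ltxx.
exists n; rewrite nx/= leNgt; apply/negP => /min.
by rewrite ltnn.
Qed.

(** Cauchy-Schwarz for the masses of the cells of a partition. *)
Lemma cell_mass_bound (I T : finType) (c : I -> T) (nu : I -> R) (w : T -> R)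
    (E : R) :
  \sum_i nu i = 1 -> (forall k, 0 < w k) -> 0 < E ->
  \sum_i \sum_(j | c i == c j) w (c i) * (nu i * nu j) <= E ->
  E^-1 <= \sum_k (w k)^-1.
Proof.
move=> nu1 w0 E0; rewrite (partition_big c predT)//=.
pose W k := \sum_(i | c i == k) nu i.
rewrite (eq_bigr (fun k => w k * W k ^+ 2)) => [wE|k _]; last first.
  rewrite expr2 /W mulr_suml mulr_sumr; apply: eq_bigr => i /eqP ci.
  rewrite ci mulr_sumr mulr_sumr; apply: eq_bigl => j.
  by rewrite eq_sym.
have W1 : \sum_k W k = 1 by rewrite -nu1 [RHS](partition_big c predT).
(* Termwise, in the form of the arithmetic-geometric mean inequality. *)
have amgm k : W k <= (E^-1 * (w k * W k ^+ 2) + E * (w k)^-1) / 2.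
  have wE0 : 0 < w k * E by rewrite mulr_gt0.
  move: (w0 k); move: (w k) (W k) wE0 => a x aE0 a0.
  rewrite ler_pdivlMr// -subr_ge0.
  have -> : E^-1 * (a * x ^+ 2) + E / a - x * 2 = (x * a - E) ^+ 2 / (a * E).
    by field; rewrite !lt0r_neq0.
  by rewrite divr_ge0 ?sqr_ge0// ltW.
have : \sum_k W k <= \sum_k (E^-1 * (w k * W k ^+ 2) + E * (w k)^-1) / 2.
  by apply: ler_sum.
rewrite W1 -mulr_suml big_split/= -!mulr_sumr ler_pdivlMr// mul1r.
rewrite -(ler_pM2l (_ : 0 < E^-1)) ?invr_gt0// in wE.
rewrite mulVf ?gt_eqF// in wE.
rewrite -div1r ler_pdivrMr// mulrC; lra.
Qed.

Context {d : nat} {K : set 'rV[R]_d} {cK : compact K}.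
Implicit Types f g : contfun R cK.

(** A multiscale form of the [u]-energy of the measure which puts mass [nu i]
    at the point of the graph above [pt i], for [U = 2 `^ u].  The strict
    inequality on the values makes it lower semicontinuous in [f]. *)
Definition energy (I : finType) (pt : I -> K) (nu : I -> R) (U : R) (N : nat)
    (f : contfun R cK) : R :=
  \sum_(n < N.+1) \sum_i
    \sum_(j | (`|\val (pt i) - \val (pt j)| <= 2^-1 ^+ n)
              && (`|f (pt i) - f (pt j)| < 2^-1 ^+ n))
      U ^+ n * (nu i * nu j).

Lemma energy_open (I : finType) (pt : I -> K) (nu : I -> R) (U : R) N (M : R) :
  (forall i, 0 <= nu i) -> 0 <= U ->
  open [set f : contfun R cK | M < energy pt nu U N f].
Proof.
move=> nu0 U0; rewrite openE => f /= Mf.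
have : nbhs f [set g : contfun R cK | forall q : 'I_N.+1 * I * I,
    `|f (pt q.1.2) - f (pt q.2)| < 2^-1 ^+ q.1.1 ->
    `|g (pt q.1.2) - g (pt q.2)| < 2^-1 ^+ q.1.1].
  pose P (q : 'I_N.+1 * I * I) : set (contfun R cK) := [set g |
    `|f (pt q.1.2) - f (pt q.2)| < 2^-1 ^+ q.1.1 ->
    `|g (pt q.1.2) - g (pt q.2)| < 2^-1 ^+ q.1.1].
  suff : forall q, nbhs f (P q) by move=> H; exact: (@filter_forall _ _ P (nbhs f) (nbhs_filter f) H).
  move=> -[[n i] j]; rewrite /P /=.
  have [fij|] := boolP (`|f (pt i) - f (pt j)| < 2^-1 ^+ n); last first.
    move=> _; apply: (@filterS _ (nbhs f) (nbhs_filter f) setT) => //; exact: filterT.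
  pose e := (2^-1 ^+ n - `|f (pt i) - f (pt j)|) / 2.
  have e0 : 0 < e by rewrite divr_gt0// subr_gt0.
  apply: filterS (nbhsx_ballx f e e0) => g.
  rewrite -ball_normE/= => fg _.
  have fgi k : `|f (pt k) - g (pt k)| < e.
    by apply: le_lt_trans fg; exact: (ler_sup_norm (f - g)).
  rewrite (_ : g (pt i) - g (pt j) = (f (pt i) - f (pt j))
     - (f (pt i) - g (pt i)) + (f (pt j) - g (pt j))); last by ring.
  rewrite (le_lt_trans (ler_normD _ _))// (le_lt_trans (lerD (ler_normB _ _) (lexx _)))//.
  have := fgi i; have := fgi j; rewrite /e; lra.
apply: filterS => g fg /=; apply: lt_le_trans Mf _.
apply: ler_sum => n _; apply: ler_sum => i _.
rewrite big_mkcond [leRHS]big_mkcond; apply: ler_sum => j _.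
have c0 : 0 <= U ^+ n * (nu i * nu j) by rewrite mulr_ge0 ?exprn_ge0// mulr_ge0.
case: ifP => [/andP[-> /(fg (n, i, j)) /= ->//]|_]; by case: ifP.
Qed.

(** The pairs of points of one covering set are counted by the energy at the
    scale of that set. *)
Lemma energy_cover_bound (I : finType) (pt : I -> K) (nu : I -> R) (U E : R) N f
    (m : nat) (z : 'I_m -> 'rV[R]_(d + 1)) (r : 'I_m -> R) (rk : 'I_m -> nat) :
  (forall i, 0 <= nu i) -> \sum_i nu i = 1 -> 0 < U -> 0 < E ->
  (forall i, exists k, `|z k - graph_point (\val (pt i)) (f (pt i))| < r k) ->
  (forall k, (rk k <= N)%N) -> (forall k, 2 * r k <= 2^-1 ^+ rk k) ->
  energy pt nu U N f <= E -> E^-1 <= \sum_k (U ^+ rk k)^-1.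
Proof.
move=> nu0 nu1 U0 E0 /choice[c cP] rkN rkr fE.
apply: (@cell_mass_bound I 'I_m c nu (fun k => U ^+ rk k)) => //.
  by move=> k; rewrite exprn_gt0.
apply: le_trans fE; rewrite /energy exchange_big/=; apply: ler_sum => i _.
have nN : (rk (c i) < N.+1)%N by rewrite ltnS.
rewrite (bigD1 (Ordinal nN))//= -[leLHS]addr0 lerD//; last first.
  by apply: sumr_ge0 => n _; apply: sumr_ge0 => j _; rewrite mulr_ge0 ?exprn_ge0 ?(ltW U0)// mulr_ge0.
rewrite big_mkcond [leRHS]big_mkcond; apply: ler_sum => j _.
have [cij|_] := eqVneq (c i) (c j); last first.
  by case: ifP => // _; rewrite mulr_ge0 ?exprn_ge0 ?(ltW U0)// mulr_ge0.
have ij : `|graph_point (\val (pt i)) (f (pt i)) - graph_point (\val (pt j)) (f (pt j))|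
    < 2^-1 ^+ rk (c i).
  apply: lt_le_trans (rkr _).
  rewrite -(subrKA (z (c i))) mulr2n mulrDl mul1r (le_lt_trans (ler_normD _ _))//.
  rewrite distrC ltrD// cij; exact: cP.
by rewrite (le_trans (dist_le_graph_point _ _ _ _) (ltW ij))
  (le_lt_trans (dist_le_graph_point_snd _ _ _ _) ij).
Qed.

End Energy.

Section GraphLowerBound.
Context {R : realType} {d : nat} {K : set 'rV[R]_d} {cK : compact K}.

(** The mass distribution principle.  In a cover by balls of radius at most 1/2,
    a ball of radius [r] has the dyadic level [n] with [2^-1 ^+ n < 4 * r], and
    the cost of the cover is at least a constant times the inverse of the energy
    at any scale finer than all these levels; it suffices to have a bound on the
    energy at arbitrarily fine scales. *)
Lemma hausdorff_dim_graph_ge (f : contfun R cK) (u M : R) : 0 < u ->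
  (forall n0 : nat, exists N (I : finType) (pt : I -> K) (nu : I -> R),
    [/\ (n0 <= N)%N, forall i, 0 <= nu i, \sum_i nu i = 1 &
        energy pt nu (2 `^ u) N f <= M]) ->
  (u%:E <= hausdorff_dim (graph f))%E.
Proof.
move=> u0 fM; apply: hausdorff_dim_ge => //; first exact: graph_compact.
have M0 : 0 < `|M| + 1 by rewrite ltr_wpDl.
have q0 : 0 < 4 `^ u :> R by rewrite powR_gt0.
exists (Num.min (2^-1 `^ u) ((`|M| + 1)^-1 / 4 `^ u)).
  by rewrite lt_min powR_gt0 ?divr_gt0// invr_gt0.
move=> l [l0 lf]; rewrite ge_min; apply/orP.
have [/hasP[p pl p2]|/hasPn l2] := boolP (has (fun p => 2^-1 < p.2) l); [left|right].
  apply: (@le_trans _ _ (p.2 `^ u)).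
    by apply: ge0_ler_powR; rewrite ?nnegrE ?ltW// l0.
  rewrite (big_rem p pl)/= lerDl sumr_ge0// => q _; exact: powR_ge0.
pose z (k : 'I_(size l)) := (nth (0, 0) l k).1.
pose r (k : 'I_(size l)) := (nth (0, 0) l k).2.
have r0 k : 0 < r k by apply: l0; exact: mem_nth.
have /choice[rk rkP] (k : 'I_(size l)) :
    exists n, 2^-1 ^+ n.+1 < 2 * r k <= 2^-1 ^+ n.
  apply: dyadic_level; first by rewrite mulr_gt0.
  have := l2 _ (mem_nth (0, 0) (ltn_ord k)); rewrite -leNgt -/(r k); lra.
have [N [I [pt [nu [rkN nu0 nu1 fE]]]]] := fM (\max_k rk k).
have := @energy_cover_bound _ _ _ _ I pt nu (2 `^ u) (`|M| + 1) N f _ z r rk nu0 nu1.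
rewrite powR_gt0// => /(_ isT M0) h.
rewrite ler_pdivrMr//; apply: le_trans (h _ _ _ _) _.
- move=> i; have [|p pl px] := lf (graph_point (\val (pt i)) (f (pt i))).
    by exists (pt i).
  have kl : (index p l < size l)%N by rewrite index_mem.
  by exists (Ordinal kl); rewrite /z /r /= nth_index.
- by move=> k; apply: leq_trans rkN; exact: leq_bigmax.
- by move=> k; case/andP: (rkP k).
- by apply: le_trans fE _; rewrite (le_trans (ler_norm M))// lerDl.
rewrite (big_nth (0, 0)) big_mkord mulr_suml; apply: ler_sum => k _.
rewrite -exprVn -half_expn_powR -/(r k) mulrC -powRM// ?(ltW (r0 k))//.
apply: ge0_ler_powR; rewrite ?nnegrE ?(ltW u0) ?exprn_ge0 ?invr_ge0//.
  by rewrite mulr_ge0// ltW.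
have /andP[+ _] := rkP k; rewrite exprS; lra.
Qed.

End GraphLowerBound.

(** * Concentration of lacunary sums of triangle waves *)

Section TriangleWave.
Context {R : realType}.
Implicit Types s t : R.

(** The distance from [t] to the nearest integer. *)
Definition triangle t : R := `|t - (Num.floor (t + 2^-1))%:~R|.

Lemma triangle_ge0 t : 0 <= triangle t.
Proof. exact: normr_ge0. Qed.

Lemma triangle_le_half t : triangle t <= 2^-1.
Proof.
rewrite /triangle; have /andP[] := floor_itv (t + 2^-1).
by rewrite intrD ler_norml => ? ?; apply/andP; split; lra.
Qed.

Lemma triangle_le_dist t (n : int) : triangle t <= `|t - n%:~R|.
Proof.
rewrite /triangle; have /andP[] := floor_itv (t + 2^-1).
set m := Num.floor _; rewrite intrD => mt tm.
have [->//|mn] := eqVneq n m.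
have [lt|lt|e] := ltgtP n m; last by rewrite e eqxx in mn.
- have : n%:~R + 1 <= m%:~R :> R by rewrite -[1]/(1%:~R) -intrD ler_int; lia.
  move=> h; rewrite (ger0_norm (x := t - n%:~R)); last by lra.
  by rewrite ler_norml; apply/andP; split; lra.
- have : m%:~R + 1 <= n%:~R :> R by rewrite -[1]/(1%:~R) -intrD ler_int; lia.
  move=> h; rewrite (ler0_norm (x := t - n%:~R)); last by lra.
  by rewrite ler_norml; apply/andP; split; lra.
Qed.

Lemma triangle_lipschitz s t : `|triangle s - triangle t| <= `|s - t|.
Proof.
have h u v : triangle u - triangle v <= `|u - v|.
  rewrite lerBlDr; set m := Num.floor (v + 2^-1).
  apply: le_trans (triangle_le_dist u m) _.
  by rewrite [triangle v]/triangle -/m (le_trans _ (ler_normD _ _))// addrA subrK.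
by rewrite ler_norml h lerNl opprB distrC h.
Qed.

Lemma triangleDn t (n : nat) : triangle (t + n%:R) = triangle t.
Proof.
have h u (m : int) : triangle (u + m%:~R) <= triangle u.
  apply: le_trans (triangle_le_dist _ (Num.floor (u + 2^-1) + m)) _.
  by rewrite intrD opprD addrACA subrr addr0.
apply/eqP; rewrite eq_le (h t n)/=.
by rewrite -{1}(addrK n%:R t) -[- n%:R]/(- (n%:Z)%:~R) -intrN h.
Qed.

(** Between two consecutive half-integers the wave is affine of slope 1 or
    -1. *)
Lemma triangle_isometry (g : nat) s t :
  g%:R / 2 <= s < g.+1%:R / 2 -> g%:R / 2 <= t < g.+1%:R / 2 ->
  `|triangle s - triangle t| = `|s - t|.
Proof.
move=> /andP[gs sg] /andP[gt tg].
have gE := odd_double_half g; set h := g./2 in gE.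
have gR : g%:R = (odd g)%:R + 2 * h%:R :> R.
  by rewrite -{1}gE natrD -mul2n natrM.
have {gE} : (g.+1%:R = g%:R + 1 :> R) by rewrite -natr1.
move: gs sg gt tg; rewrite gR => gs sg gt tg gS; rewrite gS {gS} in sg tg.
rewrite /triangle; case: (odd g) gs sg gt tg {gR} => /= gs sg gt tg.
- have fl (u : R) : (1 + 2 * h%:R) / 2 <= u -> u < (1 + 2 * h%:R + 1) / 2 ->
      Num.floor (u + 2^-1) = h.+1.
    move=> hu uh; apply: floor_def; rewrite intrD -[_%:~R]/(h.+1%:R) -natr1.
    by apply/andP; split; lra.
  rewrite (fl s)// (fl t)// -[_%:~R]/(h.+1%:R) -natr1.
  rewrite (ler0_norm (x := s - _)) 1?(ler0_norm (x := t - _)); try lra.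
  by rewrite [RHS]distrC; congr (`|_|); lra.
- have fl (u : R) : (0 + 2 * h%:R) / 2 <= u -> u < (0 + 2 * h%:R + 1) / 2 ->
      Num.floor (u + 2^-1) = h.
    move=> hu uh; apply: floor_def; rewrite intrD -[_%:~R]/(h%:R).
    by apply/andP; split; lra.
  rewrite (fl s)// (fl t)// -[_%:~R]/(h%:R).
  rewrite (ger0_norm (x := s - _)) 1?(ger0_norm (x := t - _)); try lra.
  by congr (`|_|); lra.
Qed.

End TriangleWave.

Section LacunaryWave.
Context {R : realType}.

(** The amplitudes are summable, so that the random curve is continuous, but
    decrease only polynomially: their inverses enter the concentration estimate
    and must be negligible against powers of the distance. *)
Definition amp (k : nat) : R := (k.+1 * k.+2)%:R^-1.

(** Each period is a multiple of the next one, which makes the faster waves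
    invariant under the translations used for counting, and the ratio of
    successive periods exceeds [2 ^ k], which makes the counting error
    negligible at the scale [2 ^- k]. *)
Definition freq (k : nat) : nat := 2 ^ (k + 2) ^ 2.

Lemma amp_gt0 k : 0 < amp k.
Proof. by rewrite /amp invr_gt0 ltr0n muln_gt0. Qed.

Lemma amp_telescope k : amp k = k.+1%:R^-1 - k.+2%:R^-1.
Proof.
rewrite /amp natrM.
have k1 : k.+1%:R != 0 :> R by rewrite pnatr_eq0.
have k2 : k.+2%:R != 0 :> R by rewrite pnatr_eq0.
apply: (mulIf (mulf_neq0 k1 k2)); rewrite mulVf ?mulf_neq0// mulrBl.
by rewrite mulKf// mulrCA mulVf// mulr1 -!natr1; ring.
Qed.

Lemma amp_le3S k : amp k <= 3 * amp k.+1.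
Proof.
rewrite /amp ler_pdivlMr ?ltr0n// mulrC ler_pdivrMr ?ltr0n//.
by rewrite -natrM ler_nat; nia.
Qed.

Lemma freq_gt0 k : (0 < freq k)%N.
Proof. by rewrite expn_gt0. Qed.

Lemma freqS k : freq k.+1 = (2 ^ (2 * k + 5) * freq k)%N.
Proof. by rewrite /freq -expnD; congr (2 ^ _)%N; lia. Qed.

Lemma freq_dvd k l : (k <= l)%N -> (freq k %| freq l)%N.
Proof. by move=> kl; apply: dvdn_exp2l; rewrite leq_exp2r// leq_add2r. Qed.

(** At the time scale of the [k]-th wave the slopes of the slower waves add up
    to less than half of its own. *)
Lemma slow_slopes k :
  \sum_(0 <= n < k) (2 * amp n) * (freq n)%:R <= amp k * (freq k)%:R / 2.
Proof.
elim: k => [|k IH].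
  by rewrite big_geq// divr_ge0// mulr_ge0// ltW// amp_gt0.
rewrite big_nat_recr//=.
(* The induction needs only a ratio of 15; the actual one is at least 32. *)
have h : (32 * freq k <= freq k.+1)%N.
  by rewrite freqS leq_mul2r expnD (leq_pmull 32) ?orbT// expn_gt0.
have : 32 * (freq k)%:R <= (freq k.+1)%:R :> R by rewrite -natrM ler_nat.
have := amp_le3S k; have := amp_gt0 k; have := amp_gt0 k.+1.
move: IH; set s := \sum_(0 <= n < k) _.
set f := (freq k)%:R; set f1 := (freq k.+1)%:R; set a := amp k; set a1 := amp _.
have f0 : 0 < f by rewrite ltr0n freq_gt0.
by move=> *; nra.
Qed.

Definition wave_sum (b : nat -> R) (K : nat) (t : R) : R :=
  \sum_(0 <= n < K) b n * triangle ((freq n)%:R * t).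

Lemma wave_sum_lipschitz (b : nat -> R) K s t :
  (forall n, `|b n| <= 2 * amp n) ->
  `|wave_sum b K s - wave_sum b K t| <= amp K * (freq K)%:R / 2 * `|s - t|.
Proof.
move=> bB; rewrite /wave_sum -sumrB.
apply: le_trans (ler_norm_sum _ _ _) _.
have := ler_wpM2r (normr_ge0 (s - t)) (slow_slopes K).
apply: le_trans.
rewrite mulr_suml; apply: ler_sum => n _.
rewrite -mulrBr normrM -[leRHS]mulrA ler_pM//.
apply: le_trans (triangle_lipschitz _ _) _.
by rewrite -mulrBr normrM ger0_norm.
Qed.

(** The slope of the [k]-th wave beats the slower ones, and the faster ones
    take the same values at times which differ by a multiple of their
    period. *)
Lemma wave_sum_steep (b : nat -> R) (k K j i l : nat) :
  (forall n, `|b n| <= 2 * amp n) -> amp k <= `|b k| -> (k < K)%N ->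
  i = (j + freq K %/ freq k.+1 * l)%N ->
  (j %/ (freq K %/ (2 * freq k)) = i %/ (freq K %/ (2 * freq k)))%N ->
  amp k * (freq k)%:R / 2 * ((i%:R - j%:R) / (freq K)%:R)
    <= `|wave_sum b K (i%:R / (freq K)%:R) - wave_sum b K (j%:R / (freq K)%:R)|.
Proof.
move=> bB bk kK iE0 ji.
have Q0 : (0 < freq K)%N := freq_gt0 K.
have dvd1 := freq_dvd kK.
have dvd2 : (2 * freq k %| freq K)%N.
  by apply: dvdn_trans dvd1; rewrite freqS dvdn_mul// (@dvdn_exp2l 2 1)// addn_gt0 orbT.
have q0 := freq_gt0 k.+1; have f0 := freq_gt0 k.
set Q := freq K in iE0 ji Q0 dvd1 dvd2 *; clearbody Q.
have QR : Q%:R != 0 :> R by rewrite pnatr_eq0 -lt0n.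
have Qgt0 : 0 < Q%:R :> R by rewrite ltr0n.
set D := (i%:R - j%:R) / Q%:R.
have D0 : 0 <= D by rewrite divr_ge0// subr_ge0 ler_nat iE0 leq_addr.
have iE : i%:R / Q%:R = j%:R / Q%:R + D :> R by rewrite /D; field.
have DE : D = l%:R / (freq k.+1)%:R.
  have qR : (freq k.+1)%:R != 0 :> R by rewrite pnatr_eq0 -lt0n.
  rewrite /D iE0 natrD addrC addKr natrM.
  have QE : Q%:R = (Q %/ freq k.+1)%:R * (freq k.+1)%:R :> R.
    by rewrite -natrM divnK.
  move: QR; rewrite QE mulf_eq0 negb_or => /andP[c0 _].
  by field; rewrite qR.
rewrite /wave_sum -sumrB.
rewrite (big_cat_nat (n := k)) ?(ltnW kK)//= [X in _ + X]big_ltn//=.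
rewrite [X in _ + (_ + X)]big1_seq ?addr0; last first.
  move=> n; rewrite mem_index_iota => /andP[_ /andP[kn nK]].
  rewrite iE DE mulrDr.
  have -> : (freq n)%:R * (l%:R / (freq k.+1)%:R)
      = (freq n %/ freq k.+1 * l)%:R :> R.
    rewrite -{1}(divnK (freq_dvd kn)) !natrM; field.
    by rewrite pnatr_eq0 -lt0n freq_gt0.
  by rewrite triangleDn subrr.
set T := b k * _ - b k * _.
have TE : amp k * (freq k)%:R * D <= `|T|.
  rewrite /T -mulrBr normrM -mulrA ler_pM//.
  - exact/ltW/amp_gt0.
  - by rewrite mulr_ge0.
  set G := (Q %/ (2 * freq k))%N in ji.
  have QG : (G * (2 * freq k) = Q)%N := divnK dvd2.
  have G0 : (0 < G)%N by move: Q0; rewrite -QG muln_gt0 => /andP[].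
  have hg (m : nat) : (j %/ G = m %/ G)%N ->
      (j %/ G)%:R / 2 <= ((freq k)%:R * (m%:R / Q%:R) : R) < (j %/ G).+1%:R / 2.
    move=> ->; have := divn_eq m G; set q := (m %/ G)%N => mE.
    have rG := ltn_pmod m G0; clearbody G q.
    have GR : 0 < G%:R :> R by rewrite ltr0n.
    have -> : (freq k)%:R * (m%:R / Q%:R) = m%:R / G%:R / 2 :> R.
      have fR : 0 < (freq k)%:R :> R by rewrite ltr0n.
      rewrite -QG !natrM; move: fR GR; set x := (freq k)%:R; set y := G%:R.
      by move=> x0 y0; field; rewrite !lt0r_neq0.
    have qm : q%:R <= m%:R / G%:R :> R.
      by rewrite ler_pdivlMr// -natrM ler_nat mE leq_addr.
    have mq : m%:R / G%:R < q.+1%:R :> R.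
      by rewrite ltr_pdivrMr// -natrM ltr_nat mE mulSn addnC ltn_add2r.
    by apply/andP; split; lra.
  rewrite (triangle_isometry (hg i ji) (hg j erefl)).
  by rewrite -mulrBr -mulrBl normrM ger0_norm// ger0_norm.
set L := \sum_(0 <= n < k) _.
have LE : `|L| <= amp k * (freq k)%:R / 2 * D.
  have := wave_sum_lipschitz (b := b) k (i%:R / Q%:R) (j%:R / Q%:R) bB.
  by rewrite /wave_sum -sumrB -mulrBl (ger0_norm D0).
have := ler_normD (L + T) (- L); rewrite addrAC subrr add0r normrN; lra.
Qed.

End LacunaryWave.

Section Counting.
Context {R : realType}.

Lemma card_spaced (Q m l : nat) (A : {pred 'I_Q}) (X : R) :
  (0 < m)%N -> 0 <= X -> (forall j, j \in A -> (j : nat) = l %[mod m]) ->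
  (forall i j, i \in A -> j \in A -> (j <= i)%N -> i%:R - j%:R <= X) ->
  #|A|%:R <= X / m%:R + 1.
Proof.
move=> m0 X0 Al AX; have [->|/card_gt0P[j0' Aj0']] := posnP #|A|.
  by rewrite addr_ge0// divr_ge0.
have [j0 Aj0 j0min] := arg_minnP (fun j : 'I_Q => j : nat) Aj0'.
have mR : 0 < m%:R :> R by rewrite ltr0n.
pose t := Num.trunc (X / m%:R).
pose f (j : 'I_Q) : 'I_t.+1 := inord ((j - j0) %/ m).
have jE j : j \in A -> (j = j0 + (j - j0) %/ m * m :> nat)%N.
  move=> Aj; rewrite divnK ?subnKC ?j0min//.
  by rewrite -eqn_mod_dvd ?j0min// (Al _ Aj) (Al _ Aj0).
have ft j : j \in A -> ((j - j0) %/ m < t.+1)%N.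
  move=> Aj; rewrite ltnS truncn_ge_nat ?divr_ge0//.
  rewrite ler_pdivlMr// -natrM; apply: le_trans (AX _ _ Aj Aj0 (j0min _ Aj)).
  by rewrite lerBrDl -natrD ler_nat -jE.
have fI : {in A &, injective f}.
  move=> i j Ai Aj /(congr1 val); rewrite /= !inordK ?ft// => e.
  by apply: val_inj; rewrite /= (jE i)// (jE j)// e.
rewrite -(card_in_imset fI).
have := max_card (mem [set f x | x in A]%SET); rewrite card_ord => h.
apply: (@le_trans _ _ t.+1%:R); first by rewrite ler_nat.
by rewrite -natr1 lerD2r truncn_le// divr_ge0.
Qed.

(** Cut [0, 1) into the [2 freq k] intervals on which the [k]-th wave is
    affine, and each of these into residue classes of the grid modulo the
    period of the next wave.  Along one class [wave_sum] moves by at least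
    [amp k * freq k / (2 * freq k.+1)] from one grid point to the next, so that
    it meets an interval of length [2 r] only [O(r freq k.+1 / (amp k * freq
    k)) + 1] times. *)
Lemma wave_sum_concentration (b : nat -> R) (k K : nat) (c r : R) :
  (forall n, `|b n| <= 2 * amp n) -> amp k <= `|b k| -> (k < K)%N -> 0 <= r ->
  #|[pred j : 'I_(freq K) | `|wave_sum b K (j%:R / (freq K)%:R) - c| <= r]|%:R
    <= (freq K)%:R * (8 * r / amp k + 2 * (freq k)%:R / (freq k.+1)%:R).
Proof.
move=> bB bk kK r0.
have steep := wave_sum_steep bB bk kK.
have Q0 : (0 < freq K)%N := freq_gt0 K.
have dvd1 := freq_dvd kK.
have dvd2 : (2 * freq k %| freq K)%N.
  by apply: dvdn_trans dvd1; rewrite freqS dvdn_mul// (@dvdn_exp2l 2 1)// addn_gt0 orbT.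
have q0 := freq_gt0 k.+1; have f0 := freq_gt0 k.
have a0 := @amp_gt0 R k.
set Q := freq K in steep Q0 dvd1 dvd2 *; clearbody Q.
set q := freq k.+1 in steep dvd1 q0 *; set f := freq k in steep dvd2 f0 *.
clearbody q f.
set a := amp k in steep a0 *; clearbody a.
set A := [pred j : 'I_Q | _].
set G := (Q %/ (2 * f))%N in steep; set M := (Q %/ q)%N in steep.
have QG : (G * (2 * f) = Q)%N := divnK dvd2.
have QM : (M * q = Q)%N := divnK dvd1.
have G0 : (0 < G)%N by move: Q0; rewrite -QG muln_gt0 => /andP[].
have M0 : (0 < M)%N by move: Q0; rewrite -QM muln_gt0 => /andP[].
have fR : 0 < f%:R :> R by rewrite ltr0n.
have qR : 0 < q%:R :> R by rewrite ltr0n.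
have QR : 0 < Q%:R :> R by rewrite ltr0n.
have MR : 0 < M%:R :> R by rewrite ltr0n.
have MqR : M%:R * q%:R = Q%:R :> R by rewrite -natrM QM.
have gQ (j : 'I_Q) : (j %/ G < 2 * f)%N by rewrite ltn_divLR// mulnC QG.
have mM (j : 'I_Q) : (j %% M < M)%N by rewrite ltn_pmod.
pose cell (j : 'I_Q) : 'I_(2 * f) * 'I_M := (Ordinal (gQ j), Ordinal (mM j)).
pose X := 4 * r * Q%:R / (a * f%:R).
have X0 : 0 <= X by rewrite divr_ge0// !mulr_ge0// ltW.
have cellB (p : 'I_(2 * f) * 'I_M) :
    #|[pred j | (j \in A) && (cell j == p)]|%:R <= X / M%:R + 1.
  case: p => g l; apply: (@card_spaced Q M l) => //.
    move=> j; rewrite inE => /andP[_ /eqP[_ lE]].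
    by rewrite -lE modn_mod.
  move=> i j; rewrite !inE => /andP[Ai /eqP[gi li]] /andP[Aj /eqP[gj lj]] ji.
  have iE : (i : nat) = (j + M * ((i - j) %/ M))%N.
    rewrite mulnC divnK ?subnKC// -eqn_mod_dvd//.
    by move: (congr1 val li) (congr1 val lj) => /= -> ->.
  have := steep j i _ iE; move: (congr1 val gi) (congr1 val gj) => /= -> ->.
  move=> /(_ erefl) st.
  rewrite /X ler_pdivlMr ?mulr_gt0//.
  have h : a * f%:R / 2 * ((i%:R - j%:R) / Q%:R) <= 2 * r.
    apply: le_trans st _.
    rewrite (_ : _ - _ = (wave_sum b K (i%:R / Q%:R) - c)
                       - (wave_sum b K (j%:R / Q%:R) - c)); last by ring.
    by rewrite (le_trans (ler_normB _ _))// mulr2n mulrDl mul1r lerD.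
  move: h; rewrite mulrA ler_pdivrMr// => h; lra.
rewrite -sum1_card (partition_big cell predT)//= natr_sum.
apply: (@le_trans _ _ (\sum_(p : 'I_(2 * f) * 'I_M) (X / M%:R + 1))).
  by apply: ler_sum => p _; rewrite sum1_card cellB.
rewrite sumr_const card_prod !card_ord -[leLHS]mulr_natl !natrM.
rewrite le_eqVlt; apply/orP; left; apply/eqP.
rewrite /X -MqR; move: a0 fR qR MR; clear => a0 fR qR MR.
by field; rewrite !lt0r_neq0.
Qed.

End Counting.

(** * The random curve of functions *)

Section RandomCurve.
Context {R : realType} {E : completeNormedModType R} (phi : nat -> E).
Hypothesis phi1 : forall k, `|phi k| <= 1.
Implicit Types s t : R.

Definition curve_term t (k : nat) : E :=
  (amp k * triangle ((freq k)%:R * t)) *: phi k.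

Definition curve_sum (n : nat) t : E := \sum_(0 <= k < n) curve_term t k.

Definition curve t : E := lim (series (curve_term t) @ \oo).

Lemma sum_amp m n : (m <= n)%N ->
  \sum_(m <= k < n) amp k = m.+1%:R^-1 - n.+1%:R^-1 :> R.
Proof.
elim: n => [|n IH]; first by rewrite leqn0 => /eqP->; rewrite big_geq// subrr.
rewrite leq_eqVlt => /predU1P[->|mn]; first by rewrite big_geq// subrr.
by rewrite big_nat_recr//= IH// amp_telescope addrA subrK.
Qed.

Lemma curve_tail m n t : `|\sum_(m <= k < n) curve_term t k| <= m.+1%:R^-1.
Proof.
have [nm|/ltnW mn] := leqP n m.
  by rewrite big_geq// normr0 invr_ge0.
apply: (@le_trans _ _ (\sum_(m <= k < n) amp k)); last first.
  by rewrite sum_amp// lerBlDr lerDl invr_ge0.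
rewrite (le_trans (ler_norm_sum _ _ _))//; apply: ler_sum => k _.
have a0 := @amp_gt0 R k.
rewrite normrZ normrM (gtr0_norm a0) (ger0_norm (triangle_ge0 _)) -mulrA.
rewrite ler_piMr ?(ltW a0)// mulr_ile1 ?triangle_ge0//.
by apply: le_trans (triangle_le_half _) _; rewrite invf_le1 ?ler1n.
Qed.

Lemma harmonic_small (e : R) : 0 < e -> exists n : nat, n.+1%:R^-1 < e.
Proof.
move=> e0; exists (Num.trunc e^-1); rewrite invf_plt ?posrE//.
by rewrite -truncn_le_nat.
Qed.

Lemma curve_cvg t : series (curve_term t) @ \oo --> curve t.
Proof.
suff : cvg (series (curve_term t) @ \oo) by [].
apply/cauchy_cvgP/cauchy_seriesP => e e0.
have [N Ne] := harmonic_small e0.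
exists ([set n | (N <= n)%N], [set n | (N <= n)%N]) => /=.
  by split; exists N.
move=> [m n] /= [Nm _]; apply: le_lt_trans (curve_tail _ _ _) _.
by apply: le_lt_trans Ne; rewrite lef_pV2 ?posrE// ler_nat ltnS.
Qed.

Lemma curve_sum_dist n t : `|curve t - curve_sum n t| <= n.+1%:R^-1.
Proof.
have : (fun m => `|series (curve_term t) m - curve_sum n t|) @ \oo
    --> `|curve t - curve_sum n t|.
  by apply: cvg_norm; apply: cvgB (@curve_cvg t) _; exact: cvg_cst.
move=> /cvgr_to_le; apply; exists n => // m /= nm.
rewrite /series/= /curve_sum (big_cat_nat (n := n))//= addrAC subrr add0r.
exact: curve_tail.
Qed.

Lemma curve_sum_lipschitz n s t :
  `|curve_sum n s - curve_sum n t| <= amp n * (freq n)%:R * `|s - t|.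
Proof.
rewrite /curve_sum -sumrB (le_trans (ler_norm_sum _ _ _))//.
have h0 : 0 <= amp n * (freq n)%:R :> R by rewrite mulr_ge0// ltW// amp_gt0.
apply: (@le_trans _ _ (amp n * (freq n)%:R / 2 * `|s - t|)); last first.
  by rewrite ler_wpM2r// ler_piMr// invf_le1 ?ler1n.
have := ler_wpM2r (normr_ge0 (s - t)) (slow_slopes n); apply: le_trans.
rewrite mulr_suml; apply: ler_sum => k _.
have a0 := @amp_gt0 R k.
rewrite -scalerBl normrZ -mulrBr normrM (gtr0_norm a0).
apply: (@le_trans _ _ (amp k * `|(freq k)%:R * s - (freq k)%:R * t|)).
  rewrite -[leRHS]mulr1 ler_pM ?mulr_ge0 ?(ltW a0)//.
  by rewrite ler_wpM2l ?(ltW a0)// triangle_lipschitz.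
rewrite -mulrBr normrM (ger0_norm (ler0n _ _)) mulrA ler_wpM2r// ler_wpM2r//.
by rewrite ler_peMl ?(ltW a0)// ler1n.
Qed.

Lemma curve_continuous : continuous curve.
Proof.
move=> t; apply/cvgrPdist_lt => e e0.
have [N Ne] := harmonic_small (divr_gt0 e0 (ltr0n R 3)).
pose L : R := amp N * (freq N)%:R + 1.
have L0 : 0 < L by rewrite ltr_wpDl// mulr_ge0// ltW// amp_gt0.
have : \forall s \near t, `|t - s| < e / 3 / L.
  by apply: nbhsx_ballx; rewrite !divr_gt0.
apply: filterS => s ts.
rewrite (_ : curve t - curve s = (curve t - curve_sum N t)
  + (curve_sum N t - curve_sum N s) - (curve s - curve_sum N s)); last first.
  by rewrite opprB addrA addrA !subrK.
rewrite (le_lt_trans (ler_normB _ _))//.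
rewrite (_ : e = e / 3 + e / 3 + e / 3); last by field.
apply: ltr_leD; last exact: le_trans (curve_sum_dist _ _) (ltW Ne).
rewrite (le_lt_trans (ler_normD _ _))//.
apply: ler_ltD; first exact: le_trans (curve_sum_dist _ _) (ltW Ne).
apply: le_lt_trans (curve_sum_lipschitz _ _ _) _.
move: ts; rewrite ltr_pdivlMr// mulrC; apply: le_lt_trans.
by rewrite ler_wpM2r// lerDl.
Qed.

(** The waves of index at least [n] are small altogether, and the slower ones
    hardly move over a step of the grid. *)
Lemma curve_grid (n j : nat) t :
  j%:R / (freq n)%:R <= t <= j.+1%:R / (freq n)%:R ->
  `|curve t - curve_sum n (j%:R / (freq n)%:R)| <= 2 * n.+1%:R^-1.
Proof.
move=> /andP[jt tj].
rewrite -(subrKA (curve_sum n t)) mulr2n mulrDl mul1r.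
rewrite (le_trans (ler_normD _ _))// lerD ?curve_sum_dist//.
apply: le_trans (curve_sum_lipschitz _ _ _) _.
have f0 : 0 < (freq n)%:R :> R by rewrite ltr0n freq_gt0.
have a0 := @amp_gt0 R n.
apply: (@le_trans _ _ (amp n)).
  rewrite -mulrA ler_piMr ?(ltW a0)// mulrC -ler_pdivlMr// div1r.
  rewrite ger0_norm ?subr_ge0//.
  apply: le_trans (lerB tj (lexx _)) _.
  by rewrite -mulrBl -natr1 addrAC subrr add0r mul1r.
by rewrite amp_telescope lerBlDr lerDl invr_ge0.
Qed.

End RandomCurve.

Section SeparatingWaves.
Context {R : realType} {e : nat} {K : set 'rV[R]_e.+1} {cK : compact K}.

(** The index [k] enumerates the scale [m], the coordinate and the choice
    between sine and cosine.  The [2 d] waves of the scale [m] are those of index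
    [2 d m] to [2 d m + 2 d - 1]: the index, and with it the inverse of the
    amplitude, is polynomial in [m]. *)
Definition plane_wave (k : nat) (x : 'rV[R]_e.+1) : R :=
  (if odd k then sin else cos)
    (pi * 2 ^+ (k %/ e.+1.*2) * x ord0 (inord (k./2 %% e.+1))).

Lemma plane_wave_continuous k : continuous (fun x : K => plane_wave k (\val x)).
Proof.
move=> x; rewrite /plane_wave.
set c := pi * _; set i := inord _.
have xi : (fun x : K => (\val x : 'rV[R]_e.+1) ord0 i) @ x
    --> (\val x : 'rV[R]_e.+1) ord0 i.
  apply: (@cvg_comp _ _ _ (fun x : K => \val x) (fun v : 'rV[R]_e.+1 => v ord0 i) _
    (nbhs (\val x))); first exact: (@initial_continuous K _ set_val x).
  exact: coord_continuous.
have cx : (fun x : K => c * (\val x : 'rV[R]_e.+1) ord0 i) @ x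
    --> c * (\val x : 'rV[R]_e.+1) ord0 i.
  by apply: cvgM xi; exact: cvg_cst.
by case: odd; apply: (cvg_comp _ _ cx); [exact: continuous_sin|exact: continuous_cos].
Qed.

Definition wave_fun k : contfun R cK := mk_contfun cK (@plane_wave_continuous k).

Lemma wave_fun_norm k : `|wave_fun k| <= 1.
Proof.
apply: sup_norm_le => // x /=; rewrite /plane_wave.
by case: odd; rewrite ler_norml ?cos_geN1 ?cos_le1 ?sin_geN1 ?sin_le1.
Qed.

(** The points of the unit circle with arguments [pi 2 ^ m x] and [pi 2 ^ m y]
    make an angle of at least [pi / 2], so that one of their coordinates
    differs by at least 1. *)
Lemma wave_fun_separates (x y : K) (m : nat) :
  2^-1 ^+ m.+1 < `|\val x - \val y| <= 2^-1 ^+ m ->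
  exists k, (k %/ e.+1.*2)%N = m /\ 1 <= `|wave_fun k x - wave_fun k y|.
Proof.
move=> /andP[mx xm].
have [i xi] : exists i, 2^-1 ^+ m.+1 < `|(\val x - \val y) ord0 i|.
  apply: contrapT => /forallNP h; move: mx; apply/negP; rewrite -leNgt.
  by apply: rV_norm_le => [|i]; rewrite ?exprn_ge0// leNgt; exact/negP/h.
have ix : `|(\val x - \val y) ord0 i| <= 2^-1 ^+ m.
  by apply: le_trans (rV_coord_le _ _) xm.
set X := pi * 2 ^+ m * (\val x : 'rV[R]_e.+1) ord0 i.
set Y := pi * 2 ^+ m * (\val y : 'rV[R]_e.+1) ord0 i.
pose D := `|X - Y|.
have p0 := pi_gt0 R.
have DE : D = pi * (2 ^+ m * `|(\val x - \val y) ord0 i|).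
  rewrite /D /X /Y -mulrBr !normrM mulrA (gtr0_norm p0) (ger0_norm (exprn_ge0 _ _))//.
  by rewrite !mxE.
have two0 : 2 ^+ m != 0 :> R by rewrite expf_neq0.
have tm0 : 0 <= 2 ^+ m :> R by rewrite exprn_ge0.
have D1 : pi / 2 <= D.
  rewrite DE ler_pM2l//; have := ler_wpM2l tm0 (ltW xi).
  by rewrite exprS exprVn mulrCA mulfV// mulr1.
have D2 : D <= pi.
  rewrite DE -[leRHS]mulr1 ler_pM2l//; have := ler_wpM2l tm0 ix.
  by rewrite exprVn mulfV.
have cXY : cos (X - Y) <= 0.
  have -> : cos (X - Y) = cos D.
    by rewrite /D; case: (ger0P (X - Y)) => // _; rewrite cosN.
  rewrite -[D](subrK pi) cosDpi oppr_le0 cos_ge0_pihalf//.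
  by apply/andP; split; lra.
have sq : 2 <= (cos X - cos Y) ^+ 2 + (sin X - sin Y) ^+ 2.
  have := cos2Dsin2 X; have := cos2Dsin2 Y; move: cXY; rewrite cosB.
  set a := cos X; set b := cos Y; set c := sin X; set d := sin Y.
  rewrite !sqrrB; lra.
pose k0 := (m * e.+1.*2 + i.*2)%N.
have lt_e (b : bool) : (i.*2 + b < e.+1.*2)%N by case: i {xi ix X Y D DE D1 D2 cXY sq k0} => i /=; case: b; lia.
have kdiv (b : bool) : ((k0 + b) %/ e.+1.*2 = m)%N.
  by rewrite /k0 -addnA divnMDl ?double_gt0// divn_small ?addn0.
have kmod (b : bool) : ((k0 + b)./2 %% e.+1 = i)%N.
  rewrite /k0 -doubleMr -doubleD addnC half_bit_double.
  by rewrite modnMDl modn_small.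
have kodd (b : bool) : odd (k0 + b) = b.
  by rewrite /k0 -doubleMr -doubleD oddD odd_double oddb.
have val_k (b : bool) (z : K) : wave_fun (k0 + b) z
    = (if b then sin else cos) (pi * 2 ^+ m * (\val z : 'rV[R]_e.+1) ord0 i).
  by rewrite /= /plane_wave kdiv kmod kodd inord_val.
have [h|h] := leP 1 `|cos X - cos Y|.
  by exists (k0 + false)%N; split; [exact: kdiv|rewrite !val_k].
exists (k0 + true)%N; split; [exact: kdiv|rewrite !val_k/= -/X -/Y].
rewrite leNgt; apply/negP => h'.
have c1 : (cos X - cos Y) ^+ 2 < 1.
  by rewrite -real_normK ?num_real// expr_lt1.
have s1 : (sin X - sin Y) ^+ 2 < 1.
  by rewrite -real_normK ?num_real// expr_lt1.
lra.
Qed.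

End SeparatingWaves.

(** * The expected energy *)

Section PolynomialGeometric.
Context {R : realType}.
Implicit Types (x : R) (q M : nat).

Lemma binomial_sum_step x q M :
  (1 - x) * \sum_(0 <= m < M) 'C(m + q.+1, q.+1)%:R * x ^+ m
  = \sum_(0 <= m < M) 'C(m + q, q)%:R * x ^+ m - 'C(M + q, q.+1)%:R * x ^+ M.
Proof.
elim: M => [|M IH].
  by rewrite !big_geq// add0n bin_small// mulr0 mul0r subr0.
rewrite !big_nat_recr//= mulrDr IH addSn addnS binS natrD exprS; ring.
Qed.

(** Partial sums of the binomial series of [(1 - x) ^- q.+1]. *)
Lemma sum_binomial_geometric x q M : 0 <= x -> x < 1 ->
  \sum_(0 <= m < M) 'C(m + q, q)%:R * x ^+ m <= (1 - x) ^- q.+1.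
Proof.
move=> x0 x1; have y0 : 0 < 1 - x by rewrite subr_gt0.
elim: q M => [|q IH] M.
  rewrite expr1 -div1r ler_pdivlMr// mulrC; elim: M => [|M IH].
    by rewrite big_geq// mulr0.
  rewrite (_ : _ * _ = 1 - x ^+ M.+1); first by rewrite lerBlDr lerDl exprn_ge0.
  elim: M.+1 {IH} => [|m IH]; first by rewrite big_geq// expr0 mulr0 subrr.
  by rewrite big_nat_recr//= mulrDr IH bin0 exprS; ring.
rewrite exprS invfM mulrC -ler_pdivrMr ?invr_gt0// invrK mulrC.
apply: le_trans (IH M); rewrite binomial_sum_step lerBlDr lerDl.
by rewrite mulr_ge0// exprn_ge0.
Qed.

Lemma sum_cube_geometric x M : 0 <= x -> x < 1 ->
  \sum_(0 <= m < M) (m.+1 ^ 3)%:R * x ^+ m <= 6 * (1 - x) ^- 4.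
Proof.
move=> x0 x1; have := sum_binomial_geometric 3 M x0 x1.
rewrite -(ler_pM2l (ltr0n R 6)); apply: le_trans.
rewrite mulr_sumr; apply: ler_sum => m _.
rewrite mulrA -natrM ler_wpM2r ?exprn_ge0// ler_nat.
rewrite -(_ : 3`! = 6)%N// mulnC bin_ffact !ffactnS ffactn0.
by rewrite addn3 /=; nia.
Qed.

Lemma exprn_unbounded (S c : R) : 1 < S -> exists L : nat, c <= S ^+ L.
Proof.
move=> S1; have bern L : 1 + L%:R * (S - 1) <= S ^+ L.
  elim: L => [|L IH]; first by rewrite mul0r addr0 expr0.
  rewrite exprS -natr1; have S0 : 0 <= S by lra.
  have := ler_wpM2l S0 IH; apply: le_trans.
  by have := mulr_ge0 (ler0n R L) (sqr_ge0 (S - 1)); rewrite expr2; lra.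
have y0 : 0 < S - 1 by rewrite subr_gt0.
exists (Num.trunc (`|c| / (S - 1))).+1; apply: le_trans (bern _).
have : `|c| / (S - 1) < (Num.trunc (`|c| / (S - 1))).+1%:R.
  by rewrite -truncn_le_nat.
rewrite ltr_pdivrMr// => h; have := ler_norm c; lra.
Qed.

End PolynomialGeometric.

Section DiscreteExpectation.
Context {R : realType} {e : nat} {K : set 'rV[R]_e.+1} {cK : compact K}.
Implicit Types (f g h : contfun R cK) (x y : K).
Local Notation phi := (@wave_fun R e K cK).
Local Notation D := (e.+1.*2).

Lemma contfun_sumE (F : nat -> contfun R cK) n x :
  (\sum_(0 <= k < n) F k) x = \sum_(0 <= k < n) F k x.
Proof.
elim: n => [|n IH]; first by rewrite !big_geq.
by rewrite big_nat_recr//= [RHS]big_nat_recr//= -IH.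
Qed.

Lemma curve_sum_increment n t x y :
  curve_sum phi n t x - curve_sum phi n t y
  = wave_sum (fun k => amp k * (phi k x - phi k y)) n t.
Proof.
rewrite /curve_sum !contfun_sumE -sumrB; apply: eq_bigr => k _.
rewrite /curve_term !contfunZ; ring.
Qed.

Definition grid_shift n f (j : nat) : contfun R cK :=
  f + curve_sum phi n (j%:R / (freq n)%:R).

(** Inverse of the amplitude of the waves which separate points at distance
    about [2^-1 ^+ m]: it grows polynomially in [m]. *)
Definition inv_amp_bound (m : nat) : R := (((D * m.+1).+1) ^ 2)%:R.

(** Some wave separates [x] and [y]; its index is at least [m], hence [p], so
    that the counting error of the concentration estimate is at most
    [2^-1 ^+ p]. *)
Lemma increment_concentration f x y m p n :
  2^-1 ^+ m.+1 < `|\val x - \val y| <= 2^-1 ^+ m -> (p <= m)%N ->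
  (D * m.+1 <= n)%N ->
  #|[pred j : 'I_(freq n) |
      `|grid_shift n f j x - grid_shift n f j y| <= 2 * 2^-1 ^+ p]|%:R
    <= (freq n)%:R * (17 * 2^-1 ^+ p * inv_amp_bound m).
Proof.
move=> /wave_fun_separates[k [km phik]] pm mn.
have D0 : (0 < D)%N by rewrite double_gt0.
have kD : (k < D * m.+1)%N by rewrite mulnC -ltn_divLR// km.
have mk : (m <= k)%N by rewrite -km leq_div.
pose b k' : R := amp k' * (phi k' x - phi k' y).
have bB k' : `|b k'| <= 2 * amp k'.
  rewrite normrM (gtr0_norm (amp_gt0 _)) mulrC ler_pM2r ?amp_gt0//.
  have h z : `|phi k' z| <= 1.
    by apply: le_trans (ler_sup_norm _ _) _; exact: wave_fun_norm.
  by rewrite (le_trans (ler_normB _ _))// mulr2n lerD.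
have bk : amp k <= `|b k|.
  by rewrite normrM (gtr0_norm (amp_gt0 _)) ler_peMr// ltW// amp_gt0.
have hp0 : 0 <= 2^-1 ^+ p :> R by rewrite exprn_ge0// invr_ge0.
have r0 : 0 <= 2 * 2^-1 ^+ p :> R by rewrite mulr_ge0.
have := wave_sum_concentration (f y - f x) bB bk (leq_trans kD mn) r0.
have -> : #|[pred j : 'I_(freq n) | `|wave_sum b n (j%:R / (freq n)%:R) - (f y - f x)| <= 2 * 2^-1 ^+ p]|
    = #|[pred j : 'I_(freq n) | `|grid_shift n f j x - grid_shift n f j y| <= 2 * 2^-1 ^+ p]|.
  apply: eq_card => j; rewrite !inE /grid_shift !contfunD -curve_sum_increment.
  by congr (`|_| <= _); ring.
move=> /le_trans; apply; rewrite ler_wpM2l//.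
have aA : (amp k)^-1 <= inv_amp_bound m.
  rewrite /amp invrK /inv_amp_bound ler_nat -mulnn; apply: leq_mul => //.
  exact: leq_trans kD _.
have A1 : 1 <= inv_amp_bound m by rewrite /inv_amp_bound ler1n expn_gt0.
have fr : 2 * (freq k)%:R / (freq k.+1)%:R <= 2^-1 ^+ p :> R.
  rewrite freqS natrM invfM.
  have fk0 : (freq k)%:R != 0 :> R by rewrite pnatr_eq0 -lt0n freq_gt0.
  rewrite mulrA mulrAC mulfK// natrX -exprVn.
  rewrite (_ : 2 * k + 5 = (2 * k + 4).+1)%N ?addnS// exprS mulrA mulfV// mul1r.
  by apply: ler_wiXn2l; rewrite ?invr_ge0// ?invf_le1 ?ler1n//; lia.
have : 8 * (2 * 2^-1 ^+ p) / amp k <= 16 * 2^-1 ^+ p * inv_amp_bound m.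
  by rewrite mulrA -natrM ler_wpM2l// mulr_ge0.
have : 2^-1 ^+ p <= 2^-1 ^+ p * inv_amp_bound m by rewrite ler_peMr.
lra.
Qed.

End DiscreteExpectation.

Section Expectation.
Context {R : realType} {e : nat} {K : set 'rV[R]_e.+1} {cK : compact K}.
Implicit Types (f g h : contfun R cK) (x y : K).
Local Notation D := (e.+1.*2).
Local Notation ampB := (@inv_amp_bound R e).

(** Whatever its level, a pair is accounted for by one of the terms; the last
    one is for the pairs, such as those on the diagonal, which are too close to
    be separated. *)
Lemma increment_count f x y p N' n :
  `|\val x - \val y| <= 2^-1 ^+ p -> (D * N' <= n)%N ->
  #|[pred j : 'I_(freq n) |
      `|grid_shift n f j x - grid_shift n f j y| <= 2 * 2^-1 ^+ p]|%:R
  <= (freq n)%:R *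
     (\sum_(m < N' | (p <= m)%N) (`|\val x - \val y| <= 2^-1 ^+ m)%R%:R
        * (17 * 2^-1 ^+ p * ampB m)
      + (`|\val x - \val y| <= 2^-1 ^+ N')%R%:R) :> R.
Proof.
move=> xyp Nn.
have t0 : 0 <= 2^-1 :> R by rewrite invr_ge0.
have t1 : 2^-1 <= 1 :> R by rewrite invf_le1 ?ler1n.
have sum0 (P : pred 'I_N') : 0 <= \sum_(m < N' | P m)
    (`|\val x - \val y| <= 2^-1 ^+ m)%R%:R * (17 * 2^-1 ^+ p * ampB m) :> R.
  by apply: sumr_ge0 => m _; rewrite !mulr_ge0 ?exprn_ge0.
have [xyN|Nxy] := leP `|\val x - \val y| (2^-1 ^+ N').
  apply: (@le_trans _ _ (freq n)%:R).
    by rewrite ler_nat -[leqRHS]card_ord max_card.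
  by rewrite ler_peMr// lerDr.
have xy0 : 0 < `|\val x - \val y| by apply: le_lt_trans Nxy; rewrite exprn_ge0.
have xy1 : `|\val x - \val y| <= 1 by apply: le_trans xyp _; exact: exprn_ile1.
have [m /andP[mx xm]] := dyadic_level xy0 xy1.
have lt_exp a b : 2^-1 ^+ a < 2^-1 ^+ b :> R -> (b < a)%N.
  by rewrite ltNge; apply: contraNltn => ba; exact: ler_wiXn2l.
have pm : (p <= m)%N by rewrite -ltnS; exact/lt_exp/(lt_le_trans mx).
have mN : (m < N')%N by exact/lt_exp/(lt_le_trans Nxy).
apply: le_trans (increment_concentration f (m := m) _ pm _) _.
- by rewrite mx.
- by apply: leq_trans Nn; rewrite leq_mul2l mN orbT.
rewrite ler_wpM2l// addr0 (bigD1 (Ordinal mN))//= xm mul1r lerDl.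
exact: sum0.
Qed.

(** The energy with twice the tolerance on the values, which absorbs a uniform
    perturbation of the function. *)
Definition relaxed_energy (I : finType) (pt : I -> K) (nu : I -> R) (U : R)
    (N : nat) f : R :=
  \sum_(p < N.+1) \sum_i
    \sum_(j | (`|\val (pt i) - \val (pt j)| <= 2^-1 ^+ p)
              && (`|f (pt i) - f (pt j)| <= 2 * 2^-1 ^+ p))
      U ^+ p * (nu i * nu j).

Lemma energy_le_relaxed (I : finType) (pt : I -> K) (nu : I -> R) (U : R) N f g :
  (forall i, 0 <= nu i) -> 0 <= U -> `|f - g| <= 2^-1 * 2^-1 ^+ N ->
  energy pt nu U N f <= relaxed_energy pt nu U N g.
Proof.
move=> nu0 U0 fg; apply: ler_sum => p _; apply: ler_sum => i _.
rewrite big_mkcond [leRHS]big_mkcond; apply: ler_sum => j _.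
have c0 : 0 <= U ^+ p * (nu i * nu j) by rewrite mulr_ge0 ?exprn_ge0// mulr_ge0.
case: ifP => [/andP[-> fij]|_]; last by case: ifP.
have fgk k : `|f (pt k) - g (pt k)| <= 2^-1 * 2^-1 ^+ p.
  apply: le_trans (le_trans fg _); first exact: (ler_sup_norm (f - g)).
  rewrite ler_wpM2l ?invr_ge0//; apply: ler_wiXn2l; rewrite ?invr_ge0//.
    by rewrite invf_le1 ?ler1n.
  by rewrite -ltnS.
rewrite ifT//=.
rewrite (_ : g (pt i) - g (pt j) = (f (pt i) - f (pt j))
  - (f (pt i) - g (pt i)) + (f (pt j) - g (pt j))); last by ring.
rewrite (le_trans (ler_normD _ _))// (le_trans (lerD (ler_normB _ _) (lexx _)))//.
have := fgk i; have := fgk j; have := ltW fij; lra.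
Qed.

Lemma sum_powers_le (V : R) N m : 1 <= V ->
  \sum_(p < N.+1 | (p <= m)%N) V ^+ p <= m.+1%:R * V ^+ m.
Proof.
move=> V1; apply: (@le_trans _ _ (\sum_(p < N.+1 | (p <= m)%N) V ^+ m)).
  by apply: ler_sum => p pm; apply: ler_weXn2l.
rewrite sumr_const -[leLHS]mulr_natl ler_wpM2r ?exprn_ge0 ?(le_trans ler01)//.
rewrite ler_nat.
have /subset_leq_card/leq_trans : [pred p : 'I_N.+1 | (p <= m)%N]
    \subset [set inord q | q : 'I_m.+1]%SET.
  apply/fintype.subsetP => p; rewrite inE => pm; apply/imsetP.
  by exists (inord p) => //; rewrite inordK ?ltnS// inord_val.
by apply; apply: leq_trans (leq_imset_card _ _) _; rewrite card_ord.
Qed.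

(** Average over the grid the number of close pairs: a pair at distance about
    [2^-1 ^+ m] is close in height at scale [2^-1 ^+ p] for a proportion of
    about [2^-1 ^+ p] of the grid times, which turns the factor [(2 * V) ^+ p]
    into [V ^+ p]. *)
Lemma sum_relaxed_energy (I : finType) (pt : I -> K) (nu : I -> R) (V S C : R)
    N N' n f :
  (forall i, 0 <= nu i) -> \sum_i nu i = 1 -> 1 <= V -> 0 < S -> 0 <= C ->
  (forall i m, (m <= N')%N ->
     \sum_(j | `|\val (pt i) - \val (pt j)| <= 2^-1 ^+ m) nu j <= C * S^-1 ^+ m) ->
  (D * N' <= n)%N ->
  \sum_(j < freq n) relaxed_energy pt nu (2 * V) N (grid_shift n f j)
  <= (freq n)%:R *
     (C * (17 * (\sum_(m < N') m.+1%:R * ampB m * (V / S) ^+ m)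
           + N.+1%:R * ((2 * V) ^+ N * S^-1 ^+ N'))).
Proof.
move=> nu0 nu1 V1 S0 C0 nuC Nn.
have V0 : 0 <= V by apply: le_trans V1.
have t0 : 0 <= 2^-1 :> R by rewrite invr_ge0.
pose U := 2 * V; have U0 : 0 <= U by rewrite mulr_ge0.
pose c m i j := `|\val (pt i) - \val (pt j)| <= 2^-1 ^+ m.
pose B p := \sum_(m < N' | (p <= m)%N) 17 * 2^-1 ^+ p * ampB m * (C * S^-1 ^+ m)
            + C * S^-1 ^+ N'.
have pairB p i : \sum_(j < freq n) \sum_(l | (c p i l) &&
      (`|grid_shift n f j (pt i) - grid_shift n f j (pt l)| <= 2 * 2^-1 ^+ p))
      U ^+ p * (nu i * nu l) <= U ^+ p * nu i * ((freq n)%:R * B p).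
  rewrite (exchange_big_dep (c p i))/=; last by move=> j l _ /andP[].
  apply: (@le_trans _ _ (\sum_(l | c p i l) U ^+ p * nu i * (freq n)%:R * (nu l *
      (\sum_(m < N' | (p <= m)%N) (c m i l)%:R * (17 * 2^-1 ^+ p * ampB m)
       + (c N' i l)%:R)))).
    apply: ler_sum => l cl; rewrite sumr_const -[leLHS]mulr_natl.
    have -> : #|[pred j : 'I_(freq n) | c p i l && (`|grid_shift n f j (pt i)
          - grid_shift n f j (pt l)| <= 2 * 2^-1 ^+ p)]|
        = #|[pred j : 'I_(freq n) | `|grid_shift n f j (pt i)
          - grid_shift n f j (pt l)| <= 2 * 2^-1 ^+ p]|.
      by apply: eq_card => j; rewrite !inE cl.
    have w0 : 0 <= U ^+ p * (nu i * nu l).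
      by rewrite mulr_ge0 ?exprn_ge0// mulr_ge0.
    have := ler_wpM2r w0 (increment_count f cl Nn).
    by congr (_ <= _); rewrite /c; ring.
  rewrite -mulr_sumr mulrA ler_wpM2l ?mulr_ge0 ?exprn_ge0//.
  apply: (@le_trans _ _ (\sum_l nu l *
      (\sum_(m < N' | (p <= m)%N) (c m i l)%:R * (17 * 2^-1 ^+ p * ampB m)
       + (c N' i l)%:R))).
    rewrite big_mkcond/=; apply: ler_sum => l _; case: ifP => // _.
    rewrite mulr_ge0// addr_ge0// sumr_ge0// => m _.
    by rewrite !mulr_ge0 ?exprn_ge0.
  under eq_bigr do rewrite mulrDr mulr_sumr.
  rewrite big_split/= /B lerD//; last first.
    have := nuC i N' (leqnn _); rewrite big_mkcond/=; congr (_ <= _).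
    by apply: eq_bigr => l _; rewrite -/(c N' i l); case: (c N' i l); rewrite ?mulr1 ?mulr0.
  rewrite exchange_big/=; apply: ler_sum => m pm.
  have k0 : 0 <= 17 * 2^-1 ^+ p * ampB m :> R by rewrite !mulr_ge0 ?exprn_ge0.
  have := ler_wpM2l k0 (nuC i m (ltnW (ltn_ord m))); congr (_ <= _).
  rewrite big_mkcond/= mulr_sumr; apply: eq_bigr => l _.
  by rewrite -/(c m i l); case: (c m i l); rewrite /= ?mul1r ?mul0r ?mulr0// mulrC.
rewrite /relaxed_energy exchange_big/=.
apply: (@le_trans _ _ (\sum_(p < N.+1) (freq n)%:R * (U ^+ p * B p))).
  apply: ler_sum => p _; rewrite exchange_big/=.
  apply: (@le_trans _ _ (\sum_i U ^+ p * nu i * ((freq n)%:R * B p))).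
    by apply: ler_sum => i _; exact: pairB.
  rewrite -mulr_suml -mulr_sumr nu1 mulr1.
  by rewrite mulrCA.
rewrite -mulr_sumr ler_wpM2l//.
rewrite (eq_bigr _ (fun p _ => mulrDr _ _ _)) big_split/= mulrDr lerD//; last first.
  rewrite -mulr_suml mulrCA ler_wpM2l// mulrA ler_wpM2r ?exprn_ge0 ?invr_ge0 ?(ltW S0)//.
  rewrite mulr_natl -[in leRHS](card_ord N.+1) -sumr_const.
  apply: ler_sum => p _; apply: ler_weXn2l; last by rewrite -ltnS.
  by rewrite -[1]mulr1 ler_pM// ler1n.
under eq_bigr do rewrite mulr_sumr.
rewrite (exchange_big_dep predT)//= mulrA mulr_sumr; apply: ler_sum => m _.
have k0 : 0 <= 17 * C * ampB m * S^-1 ^+ m.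
  by rewrite !mulr_ge0 ?exprn_ge0 ?invr_ge0 ?(ltW S0).
have := ler_wpM2l k0 (sum_powers_le N m V1); congr (_ <= _).
  rewrite mulr_sumr; apply: eq_bigr => p _.
  have two : 2 ^+ p * 2^-1 ^+ p = 1 :> R by rewrite -exprMn mulfV// expr1n.
  by rewrite /U exprMn -[LHS]mulr1 -[X in _ * X = _]two; ring.
by rewrite exprMn; ring.
Qed.

End Expectation.

Section UniformTime.
Context {R : realType}.
Local Notation P := (uniform_prob (@ltr01 R)).
Local Notation mu := lebesgue_measure.

Lemma uniform_prob01E (U : set R) : measurable U ->
  P U = mu (U `&` `[0, 1]%classic).
Proof.
move=> mU; rewrite /uniform_prob integral_uniform_pdf.
rewrite (eq_integral (fun=> 1%E)); last first.
  move=> t; rewrite inE => -[_]; rewrite /= in_itv/= => t01.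
  by rewrite /uniform_pdf t01 subr0 invr1.
by rewrite integral_cst ?mul1e//; apply: measurableI => //; exact: measurable_itv.
Qed.

(** A discretised union bound: the set is covered by the grid cells on which
    [F] is large, and Markov's inequality counts them. *)
Lemma uniform_prob_grid_markov (U : set R) (Q : nat) (F : nat -> R) (M C : R) :
  measurable U -> (0 < Q)%N -> 0 < M -> (forall j, 0 <= F j) ->
  \sum_(j < Q) F j <= Q%:R * C ->
  (forall t j, (j < Q)%N -> j%:R / Q%:R <= t <= j.+1%:R / Q%:R -> U t -> M < F j) ->
  (P U <= (C / M)%:E)%E.
Proof.
move=> mU Q0 M0 F0 FC UF; rewrite uniform_prob01E//.
have QR : 0 < Q%:R :> R by rewrite ltr0n.
pose cell (j : nat) : set R :=
  if M < F j then `[j%:R / Q%:R, j.+1%:R / Q%:R]%classic else set0.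
have mcell j : measurable (cell j) by rewrite /cell; case: ifP.
have cellE j : mu (cell j) = (if M < F j then Q%:R^-1 else 0)%:E.
  rewrite /cell; case: ifP => _; last by rewrite measure0.
  rewrite lebesgue_measure_itv/= lte_fin ltr_pM2r ?invr_gt0// ltr_nat ltnSn.
  by rewrite -EFinB -mulrBl -natr1 addrAC subrr add0r mul1r.
apply: (@le_trans _ _ (\sum_(j < Q) mu (cell j))%E).
  apply: content_subadditive.
  - by move=> j _; exact: mcell.
  - by apply: measurableI => //; exact: measurable_itv.
  move=> t [Ut]; rewrite /= in_itv/= => /andP[t0 t1].
  rewrite -bigcup_mkord.
  have tQ0 : 0 <= t * Q%:R by rewrite mulr_ge0.
  have jt : (Num.trunc (t * Q%:R))%:R <= t * Q%:R by rewrite truncn_le.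
  have tj : t * Q%:R < (Num.trunc (t * Q%:R)).+1%:R by rewrite -truncn_le_nat.
  have in_cell j : (j < Q)%N -> j%:R / Q%:R <= t <= j.+1%:R / Q%:R ->
      (\bigcup_(j in `I_Q) cell j) t.
    by move=> jQ jt'; exists j => //; rewrite /cell (UF t j).
  have [tQ|Qt] := ltnP (Num.trunc (t * Q%:R)) Q.
    apply: (in_cell _ tQ); rewrite ler_pdivrMr// jt/= ler_pdivlMr//.
    exact: ltW.
  have Qp : (Q.-1.+1 = Q)%N by rewrite prednK.
  apply: (in_cell Q.-1); first by rewrite Qp.
  have Qt' : Q%:R <= t * Q%:R by apply: le_trans jt; rewrite ler_nat.
  rewrite Qp divff ?gt_eqF// t1 andbT ler_pdivrMr//.
  by apply: le_trans Qt'; rewrite ler_nat leq_pred.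
rewrite (eq_bigr (fun j : 'I_Q => (if M < F j then Q%:R^-1 else 0)%:E)); last first.
  by move=> j _; rewrite cellE.
rewrite sumEFin lee_fin ler_pdivlMr// mulr_suml.
apply: (@le_trans _ _ (Q%:R^-1 * \sum_(j < Q) F j)).
  rewrite mulr_sumr; apply: ler_sum => j _; case: ifP => [/ltW MF|_].
    by rewrite ler_wpM2l ?invr_ge0.
  by rewrite mul0r mulr_ge0 ?invr_ge0.
by rewrite ler_pdivrMl.
Qed.

End UniformTime.

Section RandomEnergy.
Context {R : realType} {e : nat} {K : set 'rV[R]_e.+1} {cK : compact K}.
Local Notation phi := (@wave_fun R e K cK).
Local Notation D := (e.+1.*2).
Local Notation P := (uniform_prob (@ltr01 R)).

Lemma measurable_curve_preimage (A : set (contfun R cK)) :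
  @borel_set R (contfun R cK) A -> measurable (curve phi @^-1` A).
Proof.
move=> mA; rewrite -[X in measurable X]setTI.
have : measurable_fun (setT : set (measurableTypeR R))
    (curve phi : measurableTypeR R -> borelType (contfun R cK)).
  apply: (@measurability _ _ (measurableTypeR R) (borelType (contfun R cK)) setT
    (curve phi) (@open (contfun R cK)) erefl) => _ [B oB <-].
  rewrite setTI; apply: measurable_realfun.open_measurable.
  by have /continuousP := @curve_continuous _ _ phi wave_fun_norm; apply.
by apply.
Qed.

(** The energies of the randomly perturbed functions are tight, uniformly in
    the scale [N] and in [f].  The weights for the scale [N] are taken at the
    much finer scale [L * N], so that the diagonal, on which every pair of
    points is close, contributes a bounded amount. *)
Lemma energy_tail_bound (s q : R) : 0 < q -> q < s ->
  (exists2 eta : R, 0 < eta &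
     forall l, ball_cover K l -> eta <= \sum_(p <- l) p.2 `^ s) ->
  exists C : R, forall N : nat, exists (I : finType) (pt : I -> K) (nu : I -> R),
    [/\ forall i, 0 <= nu i, \sum_i nu i = 1 &
    forall (f : contfun R cK) (M : R), 0 < M ->
      (P [set t | (M < energy pt nu (2 `^ (q + 1)) N (curve phi t - f))%R]
        <= (C / M)%:E)%E].
Proof.
move=> q0 qs [eta eta0 etaP].
have s0 : 0 < s := lt_trans q0 qs.
have [C C0 frost] := frostman_weights cK s0 eta0 etaP.
pose V : R := 2 `^ q; pose S : R := 2 `^ s.
have V1 : 1 <= V.
  by rewrite -(powRr0 2); apply: ler_powR; rewrite ?ler1n// ltW.
have V0 : 0 < V := lt_le_trans ltr01 V1.
have VS : V < S.
  have -> : S = V * 2 `^ (s - q).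
    by rewrite -powRD ?pnatr_eq0 ?implybT// addrC subrK.
  rewrite ltr_pMr//; apply: (@le_lt_trans _ _ (1 `^ (s - q))); first by rewrite powR1.
  by apply: gt0_ltr_powR; rewrite ?subr_gt0 ?nnegrE ?ltr1n.
have VE : 2 `^ (q + 1) = 2 * V.
  by rewrite powRD ?pnatr_eq0 ?implybT// powRr1// mulrC.
have S0 : 0 < S := lt_trans V0 VS.
(* Of the factor 4, one 2 is that of [2 * V], the other beats the number
   [N.+1] of scales. *)
have [L SL] : exists L : nat, 4 * V <= S ^+ L.
  exact/exprn_unbounded/(le_lt_trans V1 VS).
pose x := V / S.
have x0 : 0 <= x by rewrite divr_ge0 ?ltW.
have x1 : x < 1 by rewrite ltr_pdivrMr// mul1r.
pose C1 := C * (17 * ((D.+1 ^ 2)%:R * (6 * (1 - x) ^- 4)) + 1).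
exists C1 => N; have [I [pt' [nu [ptK nu0 nu1 nuC]]]] := frost (L * N)%N.
pose pt i : K := SigSub (mem_set (ptK i)).
exists I, pt, nu; split => // f M M0; rewrite VE.
(* The grid must resolve the waves which separate points at distance
   [2^-1 ^+ (L * N)], and its steps must move the values by at most half the
   finest tolerance. *)
pose n := maxn (D * (L * N)) (4 * 2 ^ N).
have Dn : (D * (L * N) <= n)%N by rewrite leq_maxl.
have Nn : (4 * 2 ^ N <= n)%N by rewrite leq_maxr.
have U0 : 0 <= 2 * V by rewrite mulr_ge0// ltW.
apply: (@uniform_prob_grid_markov R _ (freq n)
  (fun j => relaxed_energy pt nu (2 * V) N (grid_shift n (- f) j))) => //.
- apply: (measurable_curve_preimage
    (A := [set g | M < energy pt nu (2 * V) N (g - f)])).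
  apply: sub_sigma_algebra.
  have := @energy_open _ _ _ cK I pt nu (2 * V) N M nu0 U0.
  have /continuousP : continuous (fun g : contfun R cK => g - f).
    by move=> g; apply: continuousB; [exact: cvg_id|exact: cst_continuous].
  by apply.
- exact: freq_gt0.
- move=> j; apply: sumr_ge0 => p _; apply: sumr_ge0 => i _; apply: sumr_ge0 => l _.
  by rewrite mulr_ge0 ?exprn_ge0// mulr_ge0.
- apply: le_trans.
    exact: (@sum_relaxed_energy _ _ _ cK I pt nu V S C N (L * N) n (- f)
      nu0 nu1 V1 S0 (ltW C0) nuC Dn).
  rewrite ler_wpM2l// /C1 ler_wpM2l ?(ltW C0)// lerD//.
    rewrite ler_wpM2l//.
    apply: (@le_trans _ _ ((D.+1 ^ 2)%:R * \sum_(0 <= m < L * N) (m.+1 ^ 3)%:R * x ^+ m)).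
      rewrite big_mkord mulr_sumr; apply: ler_sum => m _.
      rewrite mulrA ler_wpM2r ?exprn_ge0// /inv_amp_bound -!natrM ler_nat.
      have : ((D * m.+1).+1 ^ 2 <= (D.+1 * m.+1) ^ 2)%N.
        by rewrite leq_exp2r// mulSn addnC addnS ltnS leq_addr.
      move=> /(leq_mul (leqnn m.+1))/leq_trans; apply.
      by rewrite expnMn mulnCA -expnS.
    by rewrite ler_wpM2l// sum_cube_geometric.
  rewrite exprM -exprMn exprVn.
  apply: (@le_trans _ _ (N.+1%:R * 2^-1 ^+ N)).
    rewrite ler_wpM2l// ; apply: lerXn2r; rewrite ?nnegrE ?invr_ge0 ?divr_ge0 ?exprn_ge0 ?(ltW S0)//.
    rewrite ler_pdivrMr ?exprn_gt0//; lra.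
  rewrite exprVn ler_pdivrMr ?exprn_gt0// mul1r -natrX ler_nat.
  exact: ltn_expl.
move=> t j jQ tj Mt; apply: lt_le_trans Mt _.
apply: energy_le_relaxed => //.
rewrite /grid_shift [- f + _]addrC opprD opprK addrACA addNr addr0.
apply: le_trans (curve_grid wave_fun_norm tj) _.
rewrite -exprS exprVn -[leRHS]div1r ler_pdivlMr ?exprn_gt0// mulrAC ler_pdivrMr//.
by rewrite mul1r -natrX -natrM ler_nat expnS mulnA leqW.
Qed.

End RandomEnergy.

(** * Prevalence *)

Section ExceptionalSets.
Context {R : realType} {e : nat} {K : set 'rV[R]_e.+1} {cK : compact K}.
Local Notation phi := (@wave_fun R e K cK).
Local Notation P := (uniform_prob (@ltr01 R)).
Local Notation CK := (contfun R cK).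

Lemma borel_set_translate (A : set CK) (f : CK) :
  borel_set A -> borel_set [set g | A (g - f)].
Proof.
move=> mA; rewrite /borel_set -[X in measurable X]setTI.
have : measurable_fun (setT : set (borelType CK))
    ((fun g : CK => g - f) : borelType CK -> borelType CK).
  apply: (@measurability _ _ (borelType CK) (borelType CK) setT
    (fun g : CK => g - f) (@open CK) erefl) => _ [B oB <-].
  rewrite setTI; apply: sub_sigma_algebra.
  have /continuousP : continuous (fun g : CK => g - f).
    by move=> g; apply: continuousB; [exact: cvg_id|exact: cst_continuous].
  exact.
by apply.
Qed.

Lemma lt_hausdorff_dim_lower_bound (q : R) : 0 < q ->
  (q%:E < hausdorff_dim K)%E ->
  exists2 s, q < s & exists2 eta : R, 0 < eta &
    forall l, ball_cover K l -> eta <= \sum_(p <- l) p.2 `^ s.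
Proof.
move=> q0 qK.
have [s qs sK] : exists2 s, q < s & (s%:E < hausdorff_dim K)%E.
  case: (hausdorff_dim K) qK => [k| |//]; last first.
    by exists (q + 1); rewrite ?ltrDl// ltry.
  by rewrite lte_fin => qk; exists ((q + k) / 2); rewrite ?lte_fin; lra.
exists s => //; apply: contrapT => noeta.
suff : hausdorff_measure s K = 0%E.
  move=> /(hausdorff_dim_le (lt_trans q0 qs)).
  by rewrite leNgt sK.
apply: ball_cover_hausdorff_null (lt_trans q0 qs) _ => eta eta0.
apply: contrapT => nol; apply: noeta; exists eta => // l lK.
by rewrite leNgt; apply/negP => ls; apply: nol; exists l.
Qed.

Lemma measure_liminf_le (A : nat -> set R) (c : \bar R) :
  (forall n, measurable (A n)) -> (forall n, (P (A n) <= c)%E) ->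
  (P (\bigcup_n \bigcap_(N in [set N | (n <= N)%N]) A N) <= c)%E.
Proof.
move=> mA Ac; pose G n := \bigcap_(N in [set N | (n <= N)%N]) A N.
have mG n : measurable (G n) by rewrite /G; apply: bigcap_measurableType => N _; exact: mA.
have mUG : measurable (\bigcup_n G n) by apply: bigcupT_measurable.
have ndG : {homo G : n m / (n <= m)%N >-> (n <= m)%O}.
  move=> n m nm; apply/subsetPset => t Gt N /= mN; apply: Gt => /=.
  exact: leq_trans mN.
have cvG := nondecreasing_cvg_mu (mu := P) mG mUG ndG.
rewrite -/(\bigcup_n G n) -(cvg_lim _ cvG)//.
apply: lime_le; first by apply/cvg_ex; exists (P (\bigcup_n G n)).
apply: nearW => n /=; apply: le_trans (Ac n).
apply: le_measure; [rewrite inE; exact: mG|rewrite inE; exact: mA|].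
by move=> t Gt; apply: Gt => /=.
Qed.

(** The exceptional functions for one exponent: their energies at the scale [N]
    tend to infinity with [N].  By monotone continuity and the tightness of the
    energies, almost no random perturbation of a given function is of this
    kind. *)
Lemma exceptional_set (q : R) : 0 < q -> (q%:E < hausdorff_dim K)%E ->
  exists B : set CK, [/\ borel_set B,
    forall f, P [set t | B (curve phi t - f)] = 0%E &
    forall g, ~ B g -> ((q + 1)%:E <= hausdorff_dim (graph g))%E].
Proof.
move=> q0 qK; have [s qs sK] := lt_hausdorff_dim_lower_bound q0 qK.
have [C Cen] := @energy_tail_bound _ _ _ cK s q q0 qs sK.
have /choice[En EnP] : forall N, exists En : CK -> R,
    exists (I : finType) (pt : I -> K) (nu : I -> R),
    [/\ forall i, 0 <= nu i, \sum_i nu i = 1,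
      En = energy pt nu (2 `^ (q + 1)) N &
      forall (f : CK) (M : R), 0 < M ->
        (P [set t | (M < En (curve phi t - f)%R)%R] <= (C / M)%:E)%E].
  move=> N; have [I [pt [nu [nu0 nu1 tail]]]] := Cen N.
  by exists (energy pt nu (2 `^ (q + 1)) N), I, pt, nu.
have oEn N (M : R) : open [set g : CK | M < En N g].
  have [I [pt [nu [nu0 _ -> _]]]] := EnP N; apply: energy_open => //.
pose B := \bigcap_(M in [set: nat]) \bigcup_n \bigcap_(N in [set N | (n <= N)%N])
  [set g : CK | M.+1%:R < En N g].
have mB : borel_set B.
  apply: bigcapT_measurable => M; apply: bigcupT_measurable => n.
  by apply: bigcap_measurableType => N _; apply: sub_sigma_algebra; exact: oEn.
exists B; split=> // [f|g Bg].
  have mT (A : set CK) : borel_set A -> measurable [set t : R | A (curve phi t - f)].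
    move=> mA; exact: (measurable_curve_preimage (borel_set_translate f mA)).
  apply/eqP; rewrite eq_le measure_ge0 andbT.
  apply/lee_addgt0Pr => eps eps0; rewrite add0e.
  pose M := Num.trunc (`|C| / eps).
  have CM : C / M.+1%:R <= eps.
    have : `|C| / eps < M.+1%:R by rewrite -truncn_le_nat.
    rewrite ltr_pdivrMr// ler_pdivrMr// mulrC => h.
    by rewrite (le_trans (ler_norm C))// ltW.
  apply: (@le_trans _ _ (C / M.+1%:R)%:E); last by rewrite lee_fin.
  have mA N : measurable [set t : R | M.+1%:R < En N (curve phi t - f)].
    apply: (mT [set g : CK | M.+1%:R < En N g]).
    by apply: sub_sigma_algebra; exact: oEn.
  apply: le_trans (@measure_liminf_le _ _ mA _); last first.
    by move=> N; have [I [pt [nu [_ _ _ tail]]]] := EnP N; exact: tail.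
  apply: le_measure; first by rewrite inE; exact: mT.
    rewrite inE; apply: bigcupT_measurable => n; apply: bigcap_measurableType => N _.
    exact: mA.
  by move=> t; apply.
have [M BM] : exists M : nat, forall n0, exists2 N, (n0 <= N)%N & En N g <= M.+1%:R.
  apply: contrapT => noM; apply: Bg => M _; apply: contrapT => non.
  apply: noM; exists M => n0; apply: contrapT => noN; apply: non.
  exists n0 => // N /= n0N; rewrite ltNge; apply/negP => EN.
  by apply: noN; exists N.
apply: (@hausdorff_dim_graph_ge _ _ _ _ g _ M.+1%:R) => [|n0].
  by rewrite addr_gt0.
have [N n0N EN] := BM n0; exists N.
have [I [pt [nu [nu0 nu1 EE _]]]] := EnP N.
by exists I, pt, nu; split=> //; rewrite -EE.
Qed.

Definition curve_mfun : measurableTypeR R -> borelType CK := curve phi.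

Lemma measurable_curve : measurable_fun setT curve_mfun.
Proof. by move=> _ A mA; rewrite setTI; exact: measurable_curve_preimage. Qed.

HB.instance Definition _ :=
  @isMeasurableFun.Build _ _ (measurableTypeR R) (borelType CK) curve_mfun
    measurable_curve.

Definition curve_law : probability (borelType CK) R := distribution P curve_mfun.

Lemma curve_law_compactly_supported : compactly_supported curve_law.
Proof.
have cC : compact (curve phi @` `[0, 1]%classic).
  apply: continuous_compact; last exact: segment_compact.
  by apply: continuous_subspaceT; exact: (curve_continuous wave_fun_norm).
exists (curve phi @` `[0, 1]%classic) => //.
rewrite -[LHS]/(P (curve phi @^-1` (curve phi @` `[0, 1]%classic))).
rewrite uniform_prob01E; last first.
  apply: measurable_curve_preimage; rewrite /borel_set -(setCK (_ @` _)).
  apply: measurableC; apply: sub_sigma_algebra.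
  by apply: closed_openC; apply: compact_closed => //; exact: norm_hausdorff.
rewrite setIidr; last by move=> t t01; exists t.
by rewrite lebesgue_measure_itv/= lte_fin ltr01 -EFinB subr0.
Qed.

End ExceptionalSets.

Section Prevalence.
Context {R : realType} {e : nat} {K : set 'rV[R]_e.+1} {cK : compact K}.
Local Notation phi := (@wave_fun R e K cK).
Local Notation P := (uniform_prob (@ltr01 R)).
Local Notation CK := (contfun R cK).

(** Rational exponents suffice, which leaves countably many exceptional sets. *)
Lemma hausdorff_dim_graph_ge_rat (f : CK) : (0 < hausdorff_dim K)%E ->
  (forall r : rat, 0 < ratr r :> R -> ((ratr r)%:E < hausdorff_dim K)%E ->
     ((ratr r + 1)%:E <= hausdorff_dim (graph f))%E) ->
  (hausdorff_dim K + 1 <= hausdorff_dim (graph f))%E.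
Proof.
move=> K0 fr; rewrite -leeBrDr// leNgt; apply/negP => lt.
have [a a0 [aK la]] : exists2 a : R, 0 <= a &
    (a%:E < hausdorff_dim K)%E /\ (hausdorff_dim (graph f) - 1 <= a%:E)%E.
  case: (hausdorff_dim (graph f)) lt => [g| |].
  - rewrite -EFinB => lt; exists (Num.max 0 (g - 1)); first by rewrite le_max lexx.
    split; last by rewrite lee_fin le_max lexx orbT.
    by rewrite /Num.max; case: ifP.
  - by rewrite addye// ltNge leey.
  - by exists 0 => //; split => //; rewrite addNye leNye.
have [b ab bK] : exists2 b, a < b & (b%:E <= hausdorff_dim K)%E.
  case: (hausdorff_dim K) aK => [k ak| _|//]; first by exists k; rewrite -?lte_fin.
  by exists (a + 1); rewrite ?ltrDl// leey.
have [r] := rat_in_itvoo ab; rewrite in_itv/= => /andP[ar rb].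
have rK : ((ratr r)%:E < hausdorff_dim K)%E by apply: lt_le_trans bK; rewrite lte_fin.
have := fr r (le_lt_trans a0 ar) rK.
move=> h; have := le_trans (leeB h (lexx 1%E)) la.
by rewrite -EFinB addrK lee_fin leNgt ar.
Qed.

Theorem graph_dimension_prevalent : (0 < hausdorff_dim K)%E ->
  prevalent [set f : CK | hausdorff_dim (graph f) = (hausdorff_dim K + 1)%E].
Proof.
move=> K0.
have /choice[B BP] (n : nat) : exists B : set CK, [/\ borel_set B,
    forall f, P [set t | B (curve phi t - f)] = 0%E &
    forall g, ~ B g -> forall r : rat, unpickle n = Some r ->
      0 < ratr r :> R -> ((ratr r)%:E < hausdorff_dim K)%E ->
      ((ratr r + 1)%:E <= hausdorff_dim (graph g))%E].
  have empty : borel_set (set0 : set CK) by exact: measurable0.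
  have trivialB : (forall r : rat, unpickle n = Some r ->
      0 < ratr r :> R -> ~ ((ratr r)%:E < hausdorff_dim K)%E) ->
      exists B : set CK, [/\ borel_set B,
    forall f, P [set t | B (curve phi t - f)] = 0%E &
    forall g, ~ B g -> forall r : rat, unpickle n = Some r ->
      0 < ratr r :> R -> ((ratr r)%:E < hausdorff_dim K)%E ->
      ((ratr r + 1)%:E <= hausdorff_dim (graph g))%E].
    move=> no; exists set0; split => // [f|g _ r nr r0 rK].
      by rewrite (_ : [set t | _] = set0) ?measure0.
    by have := no r nr r0 rK.
  case: (unpickle n : option rat) trivialB => [r|] trivialB; last exact: trivialB.
  have [[r0 rK]|no] := pselect (0 < ratr r :> R /\ ((ratr r)%:E < hausdorff_dim K)%E).
    have [B [mB PB BG]] := @exceptional_set _ _ _ cK _ r0 rK.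
    by exists B; split => // g /BG ? _ [<-].
  by apply: trivialB => _ [<-] r0 rK; apply: no.
exists (\bigcup_n B n); last first.
  move=> f /= notdim; apply: contrapT => Bf; apply: notdim.
  apply/eqP; rewrite eq_le hausdorff_dim_graph_le/=.
  apply: hausdorff_dim_graph_ge_rat => // r r0 rK.
  have [_ _ BG] := BP (pickle r).
  apply: BG => //; last by rewrite pickleK.
  by move=> Br; apply: Bf; exists (pickle r).
split; first by apply: bigcupT_measurable => n; case: (BP n).
exists (curve_law (cK := cK)); first exact: curve_law_compactly_supported.
move=> f.
have mB n : measurable [set t | B n (curve phi t - f)].
  have [mBn _ _] := BP n.
  exact: (measurable_curve_preimage (borel_set_translate f mBn)).
have -> : curve_law (cK := cK) [set f + b | b in \bigcup_n B n]
    = P (\bigcup_n [set t | B n (curve phi t - f)]).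
  rewrite /curve_law /distribution /pushforward; congr (P _).
  apply/seteqP; split => [t [b [n _ Bb] bt]|t [n _ Bt]].
    by exists n => //=; rewrite -[curve phi t]bt addrAC subrr add0r.
  by exists (curve phi t - f); [exists n|rewrite addrC subrK].
apply/eqP; rewrite eq_le measure_ge0 andbT.
apply: le_trans (measure_sigma_subadditive P mB _ _) _; [exact: bigcupT_measurable|exact: subset_refl|].
by rewrite eseries0// => n _ _; have [_ PB _] := BP n; exact: PB.
Qed.

End Prevalence.

Theorem theorem3 (R : realType) (d : nat) (hd : (1 <= d)%N)
    (K : set 'rV[R]_d) (cK : compact K) (hK : (0 < hausdorff_dim K)%E) :
  prevalent
    [set f : contfun R cK | hausdorff_dim (graph f) = (hausdorff_dim K + 1)%E].
Proof.
by case: d hd K cK hK => [//|e] _ K cK; exact: graph_dimension_prevalent.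
Qed.
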